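(* Let $k=2$ and let $c_1\le c_2$ be real numbers. Consider the two-dimensional forward-Euler DDG scheme on rectangular meshes for $M(x,y)\partial_tu=\nabla\cdot(A\nabla u)$, $A=\begin{pmatrix}a&c\\c&b\end{pmatrix}$ constant and nonnegative definite, with periodic boundary conditions: given $u_h^n\in V_h$, find $u_h^{n+1}\in V_h$ such that for all $v\in V_h$ and all $i,j$, $$\begin{aligned}\int_{K_{ij}}Mu_h^{n+1}v\,dxdy=&\int_{K_{ij}}Mu_h^nv\,dxdy-\tau\int_{K_{ij}}A\nabla u_h^n\cdot\nabla v\,dxdy\\&+\tau\int_{\partial K_{ij}}A\widehat{\nabla u_h^n}\cdot\nu\,v\,ds+\tau\int_{\partial K_{ij}}A\nabla v\cdot\nu\,(u_h^n-\{u_h^n\})\,ds,\end{aligned}$$ with the update of weighted cell averages evaluated by an $L$-point Gauss–Lobatto rule, $L\ge\frac{k+3}2$, as specified in the context. Assume the mesh is regularly shaped, i.e. $\kappa^{-1}\le\frac{\Delta x}{\Delta y}\le\kappa$ for some constant $\kappa>0$, and that the flux parameters $(\beta_0,\beta_1)$ satisfy $$\beta_0\ge1+\frac{\kappa|c|}{2\hat\omega^1\min\{a,b\}}\quad\text{and}\quad\tfrac18\le\beta_1\le\tfrac14 .$$ If $u_h^n(x,y)\in[c_1,c_2]$ for all $(x,y)\in S_{ij}$ and all $i,j$, then there exists $\mu_0>0$ such that if $\mu=\frac{\tau}{(\Delta x)^2}+\frac{\tau}{(\Delta y)^2}\le\mu_0$, the cell averages satisfy $\bar u_{ij}^{n+1}\in[c_1,c_2]$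 for all $i,j$. More precisely, $$\mu_0=\min_{i,j}\underline\omega_{ij}\ \min\left\{\frac{\hat\omega^1}{\hat\omega^1\max\{a,b\}\big(\beta_0+\frac{8\beta_1-2}{1+\gamma}\big)+\kappa|c|},\ \frac{1-\gamma^2}{4\max\{a,b\}(1-4\beta_1)}\right\},$$ where $\underline\omega_{ij}>0$ is defined in the context and $\gamma=\max\{|\gamma^x|,|\gamma^y|\}\le8\beta_1-1$.
   Context: Mesh and space. $\Omega=I\times J$ is a rectangle partitioned into $K_{ij}=I_i\times J_j$, $I_i=[x_{i-\frac12},x_{i+\frac12}]$, $J_j=[y_{j-\frac12},y_{j+\frac12}]$, $1\le i\le N_x$, $1\le j\le N_y$, uniform with sides $\Delta x,\Delta y$ and cell centers $(x_i,y_j)$; periodic boundary conditions (indices and traces are periodic). $V_h=\{v\in L^2(\Omega):v|_{K_{ij}}\in Q^k(K_{ij})\}$, with $Q^k(K_{ij})$ the tensor product of polynomials of degree at most $k$ in $x$ and in $y$. $M(x,y)>0$ is given; $\tau>0$ is the time step; $\nu$ is the outward unit normal. Across an interface, $[v]=v^+-v^-$ and $\{v\}=\frac12(v^++v^-)$, where $+$ is the right (resp. upper) side. Flux $\widehat{\nabla u_h}=(\widehat{\partial_xu_h},\widehat{\partial_yu_h})^\top$: on $x=x_{i+\frac12}$, $\widehat{\partial_xu_h}=\frac{\beta_0}{\Delta x}[u_h]+\{\partial_xu_h\}+\beta_1\Delta x[\partial_x^2u_h]$ and $\widehat{\partial_yu_h}=\{\partial_yu_h\}$; on $y=y_{j+\frac12}$,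 $\widehat{\partial_yu_h}=\frac{\beta_0}{\Delta y}[u_h]+\{\partial_yu_h\}+\beta_1\Delta y[\partial_y^2u_h]$ and $\widehat{\partial_xu_h}=\{\partial_xu_h\}$. Cell averages. The weighted cell average is $\langle u_h\rangle_{ij}=\frac1{\Delta x\Delta y}\int_{K_{ij}}Mu_h\,dxdy$, and the cell average is $$\bar u_{ij}=\frac{\int_{K_{ij}}Mu_h\,dxdy}{\int_{K_{ij}}M\,dxdy}=\frac{\langle u_h\rangle_{ij}}{\langle1\rangle_{ij}}.$$ Put $\mu_x=\frac\tau{(\Delta x)^2}$, $\mu_y=\frac\tau{(\Delta y)^2}$, $\mu=\mu_x+\mu_y$. Taking $v=1$ on $K_{ij}$, the scheme gives $$\langle u_h^{n+1}\rangle_{ij}=\frac{\mu_x}\mu\,\frac1{\Delta y}\int_{J_j}H_1(y)\,dy+\frac{\mu_y}\mu\,\frac1{\Delta x}\int_{I_i}H_2(x)\,dx+B,$$ $$H_1(y)=\frac1{\Delta x}\int_{I_i}M(x,y)u_h^n\,dx+\mu\Delta x\,a\widehat{\partial_xu_h^n}\Big|_{x_{i-\frac12}}^{x_{i+\frac12}},\qquad H_2(x)=\frac1{\Delta y}\int_{J_j}M(x,y)u_h^n\,dy+\mu\Delta y\,b\widehat{\partial_yu_h^n}\Big|_{y_{j-\frac12}}^{y_{j+\frac12}},$$ $$B=\frac{c\tau}{\Delta x\Delta y}\Big[\int_{J_j}\{\partial_yu_h^n\}\,dy\Big|_{x_{i-\frac12}}^{x_{i+\frac12}}+\int_{I_i}\{\partial_xu_h^n\}\,dx\Big|_{y_{j-\frac12}}^{y_{j+\frac12}}\Big].$$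 Quadrature. $\hat S_i^x=\{x_{i-\frac12}=\hat x_i^1<\dots<\hat x_i^L=x_{i+\frac12}\}$ and $\hat S_j^y=\{y_{j-\frac12}=\hat y_j^1<\dots<\hat y_j^L=y_{j+\frac12}\}$ are the $L$-point Gauss–Lobatto nodes on $I_i$, $J_j$, with weights $\hat\omega^\sigma$, $\sum_{\sigma=1}^L\hat\omega^\sigma=1$ (so $\hat\omega^1=\hat\omega^L=\frac1{L(L-1)}$). The integrals of $H_1$ and $H_2$ on the right-hand side are evaluated with this rule, giving the scheme $$\langle u_h^{n+1}\rangle_{ij}=\frac{\mu_x}\mu\sum_{\sigma=1}^L\hat\omega^\sigma H_1(\hat y_j^\sigma)+\frac{\mu_y}\mu\sum_{\sigma=1}^L\hat\omega^\sigma H_2(\hat x_i^\sigma)+B.$$ Weighted interval averages. $$\langle\phi(\xi)\rangle_i(y)=\tfrac12\int_{-1}^1M(x_i+\tfrac{\Delta x}2\xi,y)\phi(\xi)\,d\xi,\qquad\langle\phi(\eta)\rangle_j(x)=\tfrac12\int_{-1}^1M(x,y_j+\tfrac{\Delta y}2\eta)\phi(\eta)\,d\eta .$$ Test set. $\gamma^x,\gamma^y$ satisfy, for all $i,j,\sigma$, $$\frac{\langle\xi-\xi^2\rangle_i}{\langle1-\xi\rangle_i}(\hat y_j^\sigma)<\gamma^x<\frac{\langle\xi+\xi^2\rangle_i}{\langle1+\xi\rangle_i}(\hat y_j^\sigma),\qquad\frac{\langle\eta-\eta^2\rangle_j}{\langle1-\eta\rangle_j}(\hat x_i^\sigma)<\gamma^y<\frac{\langle\eta+\eta^2\rangle_j}{\langle1+\eta\rangle_j}(\hat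 x_i^\sigma),$$ and $|\gamma^x|,|\gamma^y|\le8\beta_1-1$. With $S_i^x=x_i+\frac{\Delta x}2\{-1,\gamma^x,1\}$ and $S_j^y=y_j+\frac{\Delta y}2\{-1,\gamma^y,1\}$, set $S_{ij}=(S_i^x\otimes\hat S_j^y)\cup(\hat S_i^x\otimes S_j^y)$; values of $u_h^n$ on $S_{ij}$ are those of $u_h^n|_{K_{ij}}$. Weights. $$\tilde\omega_i^{x,1}(\gamma^x,y)=\frac{\langle\gamma^x-\xi(1+\gamma^x)+\xi^2\rangle_i(y)}{2(1+\gamma^x)},\qquad\tilde\omega_i^{x,2}(\gamma^x,y)=\frac{\langle1-\xi^2\rangle_i(y)}{1-(\gamma^x)^2},$$ $$\tilde\omega_j^{y,1}(\gamma^y,x)=\frac{\langle\gamma^y-\eta(1+\gamma^y)+\eta^2\rangle_j(x)}{2(1+\gamma^y)},\qquad\tilde\omega_j^{y,2}(\gamma^y,x)=\frac{\langle1-\eta^2\rangle_j(x)}{1-(\gamma^y)^2},$$ with $\tilde\omega_i^{x,1}(-\gamma^x,y)$ and $\tilde\omega_j^{y,1}(-\gamma^y,x)$ obtained by changing the sign of $\gamma^x$, $\gamma^y$ in these formulas, and $$\underline\omega_{ij}=\min_{\gamma^x,\gamma^y,\ x\in\hat S_i^x,\ y\in\hat S_j^y}\{\tilde\omega_i^{x,1}(\pm\gamma^x,y),\ \tilde\omega_i^{x,2}(\gamma^x,y),\ \tilde\omega_j^{y,1}(\pm\gamma^y,x),\ \tilde\omega_j^{y,2}(\gamma^y,x)\},$$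 the minimum including both choices of sign. A quotient with zero denominator in $\mu_0$ is read as $+\infty$.
   Formalization: The cell average is normalized by the quadrature value of ⟨1⟩ (by the exact ⟨1⟩ only when the rule evaluates ⟨1⟩ exactly), and the weight at the node +1 is ⟨−γ+ξ(1−γ)+ξ²⟩/(2(1−γ)) instead of the first weight with only the sign of γ changed (likewise in y). *)

(* Defs.v *)
From HB Require Import structures.
From mathcomp Require Import all_boot all_order all_algebra.
From mathcomp Require Import all_classical all_reals all_analysis.

Set Implicit Arguments.
Unset Strict Implicit.
Unset Printing Implicit Defensive.

Import Order.TTheory GRing.Theory Num.Theory.
Import numFieldNormedType.Exports.

Local Open Scope classical_set_scope.
Local Open Scope ring_scope.

(* Cells are numbered from 0: the cell (i, j) of the code is K_(i+1)(j+1). *)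
Record mesh (R : realType) := Mesh {
  nx : nat; ny : nat;
  xmin : R; ymin : R;
  dx : R; dy : R;
  nx_gt0 : (0 < nx)%N; ny_gt0 : (0 < ny)%N;
  dx_gt0 : 0 < dx; dy_gt0 : 0 < dy }.

Section Mesh.
Context (R : realType) (m : mesh R).

Definition xl (i : 'I_(nx m)) : R := xmin m + i%:R * dx m.
Definition xr (i : 'I_(nx m)) : R := xmin m + i.+1%:R * dx m.
Definition yb (j : 'I_(ny m)) : R := ymin m + j%:R * dy m.
Definition yt (j : 'I_(ny m)) : R := ymin m + j.+1%:R * dy m.

(* The affine images x_i + (dx/2) xi and y_j + (dy/2) eta of a reference
   coordinate in [-1, 1]. *)
Definition xat (i : 'I_(nx m)) (xi : R) : R := (xl i + xr i) / 2 + dx m / 2 * xi.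
Definition yat (j : 'I_(ny m)) (eta : R) : R := (yb j + yt j) / 2 + dy m / 2 * eta.

Definition Icell (i : 'I_(nx m)) : set R := `[xl i, xr i].
Definition Jcell (j : 'I_(ny m)) : set R := `[yb j, yt j].

Definition Omega : set (R * R) :=
  `[xmin m, xmin m + (nx m)%:R * dx m] `*` `[ymin m, ymin m + (ny m)%:R * dy m].

(* Piecewise functions: one function per cell. A trace on an edge is the value
   of the function of the cell from which the limit is taken. *)
Definition broken := 'I_(nx m) -> 'I_(ny m) -> R -> R -> R.

Definition Qpoly (k : nat) (p : R -> R -> R) : Prop :=
  exists C : 'M[R]_k.+1, forall x y,
    p x y = \sum_(s < k.+1) \sum_(t < k.+1) C s t * x ^+ s * y ^+ t.

Definition Vh (k : nat) (u : broken) : Prop := forall i j, Qpoly k (u i j).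

Definition dX (u : broken) : broken := fun i j x y => derive1 (fun t : R => u i j t y) x.
Definition dY (u : broken) : broken := fun i j x y => derive1 (fun t : R => u i j x t) y.

(* Jump and average across the right edge of column i, resp. the upper edge of
   row j. By periodicity the cell beyond the last one is the first one; [ordS]
   and [ord_pred] are the cyclic successor and predecessor on 'I_n. The left
   edge of column i is the right edge of column [ord_pred i]. *)
Definition jumpX (g : broken) i j (y : R) : R :=
  g (ordS i) j (xl (ordS i)) y - g i j (xr i) y.
Definition meanX (g : broken) i j (y : R) : R :=
  (g (ordS i) j (xl (ordS i)) y + g i j (xr i) y) / 2.
Definition jumpY (g : broken) i j (x : R) : R :=
  g i (ordS j) x (yb (ordS j)) - g i j x (yt j).
Definition meanY (g : broken) i j (x : R) : R :=
  (g i (ordS j) x (yb (ordS j)) + g i j x (yt j)) / 2.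

End Mesh.

Section Scheme.
Context (R : realType) (m : mesh R).
(* [M] is the weight, [a], [b], [c] are the entries of A = ((a, c), (c, b)). *)
Context (M : R -> R -> R) (a b c beta0 beta1 tau : R).

Definition intI (i : 'I_(nx m)) (f : R -> R) : R :=
  \int[lebesgue_measure]_(x in Icell i) f x.
Definition intJ (j : 'I_(ny m)) (f : R -> R) : R :=
  \int[lebesgue_measure]_(y in Jcell j) f y.
Definition intK (i : 'I_(nx m)) (j : 'I_(ny m)) (f : R -> R -> R) : R :=
  \int[(lebesgue_measure \x lebesgue_measure)%E]_(z in Icell i `*` Jcell j) f z.1 z.2.

(* Normal component of the numerical flux on vertical and horizontal edges; the
   tangential component is [meanX (dY u)], resp. [meanY (dX u)]. *)
Definition fluxX (u : broken m) i j (y : R) : R :=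
  beta0 / dx m * jumpX u i j y + meanX (dX u) i j y
  + beta1 * dx m * jumpX (dX (dX u)) i j y.
Definition fluxY (u : broken m) i j (x : R) : R :=
  beta0 / dy m * jumpY u i j x + meanY (dY u) i j x
  + beta1 * dy m * jumpY (dY (dY u)) i j x.

(* Integral over the boundary of K_ij of F . nu, given the component of F along
   the x axis on the right and left edges and along the y axis on the upper and
   lower edges. *)
Definition intdK i j (Fright Fleft Fup Fdown : R -> R) : R :=
  intJ j Fright - intJ j Fleft + intI i Fup - intI i Fdown.

Definition volume_term (u v : broken m) i j : R :=
  intK i j (fun x y =>
    (a * dX u i j x y + c * dY u i j x y) * dX v i j x y
    + (c * dX u i j x y + b * dY u i j x y) * dY v i j x y).

Definition flux_term (u v : broken m) i j : R :=
  intdK i j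
    (fun y => (a * fluxX u i j y + c * meanX (dY u) i j y) * v i j (xr i) y)
    (fun y => (a * fluxX u (ord_pred i) j y + c * meanX (dY u) (ord_pred i) j y)
              * v i j (xl i) y)
    (fun x => (c * meanY (dX u) i j x + b * fluxY u i j x) * v i j x (yt j))
    (fun x => (c * meanY (dX u) i (ord_pred j) x + b * fluxY u i (ord_pred j) x)
              * v i j x (yb j)).

Definition interface_term (u v : broken m) i j : R :=
  intdK i j
    (fun y => (a * dX v i j (xr i) y + c * dY v i j (xr i) y)
              * (u i j (xr i) y - meanX u i j y))
    (fun y => (a * dX v i j (xl i) y + c * dY v i j (xl i) y)
              * (u i j (xl i) y - meanX u (ord_pred i) j y))
    (fun x => (c * dX v i j x (yt j) + b * dY v i j x (yt j))
              * (u i j x (yt j) - meanY u i j x))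
    (fun x => (c * dX v i j x (yb j) + b * dY v i j x (yb j))
              * (u i j x (yb j) - meanY u i (ord_pred j) x)).

Definition ddg_equation (un un1 v : broken m) i j : Prop :=
  intK i j (fun x y => M x y * un1 i j x y * v i j x y) =
  intK i j (fun x y => M x y * un i j x y * v i j x y)
  - tau * volume_term un v i j + tau * flux_term un v i j
  + tau * interface_term un v i j.

Definition wavg (u : broken m) i j : R :=
  (dx m * dy m)^-1 * intK i j (fun x y => M x y * u i j x y).

Definition uone : broken m := fun _ _ _ _ => 1.

Definition cell_avg (u : broken m) i j : R := wavg u i j / wavg uone i j.

Definition mux : R := tau / dx m ^+ 2.
Definition muy : R := tau / dy m ^+ 2.
Definition mu : R := mux + muy.

Definition lineX (u : broken m) i j (y : R) : R :=
  (dx m)^-1 * intI i (fun x => M x y * u i j x y).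
Definition lineY (u : broken m) i j (x : R) : R :=
  (dy m)^-1 * intJ j (fun y => M x y * u i j x y).

Definition H1 (u : broken m) i j (y : R) : R :=
  lineX u i j y
  + mu * dx m * (a * fluxX u i j y - a * fluxX u (ord_pred i) j y).
Definition H2 (u : broken m) i j (x : R) : R :=
  lineY u i j x
  + mu * dy m * (b * fluxY u i j x - b * fluxY u i (ord_pred j) x).

Definition crossB (u : broken m) i j : R :=
  c * tau / (dx m * dy m) *
  ((intJ j (meanX (dY u) i j) - intJ j (meanX (dY u) (ord_pred i) j))
   + (intI i (meanY (dX u) i j) - intI i (meanY (dX u) i (ord_pred j)))).

(* The L-point Gauss-Lobatto rule on [-1, 1]: the nodes z 0 < ... < z L.-1
   contain both end points and the rule with weights w is exact up to degree
   2 L - 3. The weights are normalized to have sum 1, whence the factor 1/2.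
   The values of z and w at indices >= L are irrelevant. *)
Definition gauss_lobatto (L : nat) (z w : nat -> R) : Prop :=
  [/\ z 0%N = -1, z L.-1 = 1,
      forall s t : nat, (s < t < L)%N -> z s < z t
    & forall p : {poly R}, (size p <= L.*2 - 2)%N ->
        \sum_(s < L) w s * p.[z s]
        = 1 / 2 * \int[lebesgue_measure]_(x in `[(-1 : R), 1]) p.[x]].

Definition quadXY (L : nat) (z w : nat -> R) i j (f g : R -> R) : R :=
  mux / mu * (\sum_(s < L) w s * f (@yat R m j (z s)))
  + muy / mu * (\sum_(s < L) w s * g (@xat R m i (z s))).

Definition wavg_update (L : nat) (z w : nat -> R) (un un1 : broken m) i j : Prop :=
  wavg un1 i j = quadXY L z w i j (H1 un i j) (H2 un i j) + crossB un i j.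

(* The value that the quadrature of the scheme gives to the weighted average
   <u>_ij. For a general weight [M] it differs from [wavg u], also for u = 1. *)
Definition wavg_quad (L : nat) (z w : nat -> R) (u : broken m) i j : R :=
  quadXY L z w i j (lineX u i j) (lineY u i j).

(* The test function 1 gives the update of the weighted cell averages, where
   quadrature replaces two of the exact integrals. Hence the equation with exact
   integrals is required only on the complement of the constants in Q^k(K_ij). *)
Definition ddg_scheme (k L : nat) (z w : nat -> R) (un un1 : broken m) : Prop :=
  [/\ Vh k un1,
      forall v : broken m, Vh k v ->
        forall i j, intK i j (v i j) = 0 -> ddg_equation un un1 v i j
    & forall i j, wavg_update L z w un un1 i j].

End Scheme.
Arguments uone {R} m.

Section Weights.
Context (R : realType) (m : mesh R) (M : R -> R -> R).
Context (L : nat) (z : nat -> R) (gx gy : R).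

Definition refavgX (i : 'I_(nx m)) (phi : R -> R) (y : R) : R :=
  1 / 2 * \int[lebesgue_measure]_(xi in `[(-1 : R), 1]) (M (xat i xi) y * phi xi).
Definition refavgY (j : 'I_(ny m)) (phi : R -> R) (x : R) : R :=
  1 / 2 * \int[lebesgue_measure]_(eta in `[(-1 : R), 1]) (M x (yat j eta) * phi eta).

Definition gamma_bounds (avg : (R -> R) -> R) (g : R) : Prop :=
  avg (fun t => t - t ^+ 2) / avg (fun t => 1 - t) < g
  /\ g < avg (fun t => t + t ^+ 2) / avg (fun t => 1 + t).

Definition gammas_admissible (beta1 : R) : Prop :=
  [/\ forall i j s, (s < L)%N -> gamma_bounds (fun phi => refavgX i phi (@yat R m j (z s))) gx,
      forall i j s, (s < L)%N -> gamma_bounds (fun phi => refavgY j phi (@xat R m i (z s))) gy,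
      `|gx| <= 8 * beta1 - 1 & `|gy| <= 8 * beta1 - 1].

Definition testX (i : 'I_(nx m)) : set R := [set xat i xi | xi in [set -1; gx; 1]].
Definition testY (j : 'I_(ny m)) : set R := [set yat j eta | eta in [set -1; gy; 1]].
Definition nodesX (i : 'I_(nx m)) : set R := [set xat i (z s) | s in [set s | (s < L)%N]].
Definition nodesY (j : 'I_(ny m)) : set R := [set yat j (z s) | s in [set s | (s < L)%N]].

Definition test_set i j : set (R * R) :=
  (testX i `*` nodesY j) `|` (nodesX i `*` testY j).

(* Weights of the quadratic interpolation of u at -1, g, 1. [wend 1] is the
   weight of the node -1; [wend (-1)] is its mirror image, the weight
   <- g + t (1 - g) + t^2> / (2 (1 - g)) of the node 1. The reflection changes
   the sign of t as well as that of g: with the sign of g alone the quotient is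
   an interpolation weight only if <t> = 0, and it need not be positive under
   [gamma_bounds]. *)
Definition wend (avg : (R -> R) -> R) (sgn g : R) : R :=
  avg (fun t => sgn * g - sgn * t * (1 + sgn * g) + t ^+ 2) / (2 * (1 + sgn * g)).
Definition wmid (avg : (R -> R) -> R) (g : R) : R :=
  avg (fun t => 1 - t ^+ 2) / (1 - g ^+ 2).
Definition wmin (avg : (R -> R) -> R) (g : R) : R :=
  Num.min (Num.min (wend avg 1 g) (wend avg (-1) g)) (wmid avg g).

Definition omega_min i j : \bar R :=
  \big[Order.min/+oo%E]_(s < L)
    (Num.min (wmin (fun phi => refavgX i phi (@yat R m j (z s))) gx)
             (wmin (fun phi => refavgY j phi (@xat R m i (z s))) gy))%:E.

End Weights.

(* Quotient read as +oo when the denominator vanishes. *)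
Definition quot_oo (R : realType) (p q : R) : \bar R :=
  if q == 0 then +oo%E else (p / q)%:E.

Definition mu_bound (R : realType) (m : mesh R) (M : R -> R -> R)
    (L : nat) (z w : nat -> R) (gx gy a b c beta0 beta1 kappa : R) : \bar R :=
  let g := Num.max `|gx| `|gy| in
  ((\big[Order.min/+oo]_(i < nx m) \big[Order.min/+oo]_(j < ny m)
      omega_min M L z gx gy i j)
   * Order.min
       (quot_oo (w 0%N)
          (w 0%N * Num.max a b * (beta0 + (8 * beta1 - 2) / (1 + g)) + kappa * `|c|))
       (quot_oo (1 - g ^+ 2) (4 * Num.max a b * (1 - 4 * beta1))))%E.

(* [M] is positive on Omega, integrable there, and integrable along the lines
   through the quadrature nodes on which one-dimensional averages are taken. *)
Definition admissible_weight (R : realType) (m : mesh R) (L : nat)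
    (z : nat -> R) (M : R -> R -> R) : Prop :=
  [/\ forall x y, Omega m (x, y) -> 0 < M x y,
      (lebesgue_measure \x lebesgue_measure)%E.-integrable (Omega m)
        (fun p => (M p.1 p.2)%:E),
      forall (i : 'I_(nx m)) (j : 'I_(ny m)) (s : nat), (s < L)%N ->
        lebesgue_measure.-integrable (Icell i) (fun x => (M x (yat j (z s)))%:E)
    & forall (i : 'I_(nx m)) (j : 'I_(ny m)) (s : nat), (s < L)%N ->
        lebesgue_measure.-integrable (Jcell j) (fun y => (M (xat i (z s)) y)%:E)].

Definition nonneg_definite (R : realType) (a b c : R) : Prop :=
  forall s t : R, 0 <= a * s ^+ 2 + 2 * c * s * t + b * t ^+ 2.

(* Main.v *)
Require Import Defs.
From mathcomp Require Import all_boot all_order all_algebra.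
From mathcomp Require Import all_classical all_reals all_analysis.
From mathcomp Require Import measurable_realfun.
From mathcomp Require Import ring lra zify.

(** Along a line through a Gauss-Lobatto node, parallel to an axis, the numerical
    solution is on each cell a quadratic polynomial, hence it is determined by its
    values at the three reference points -1, g, 1, which are all values on the test
    set. The proof writes the new weighted average as a linear combination of such
    values and shows that every coefficient is nonnegative. Constants are preserved,
    so the coefficients add up to the quadrature value of the average of 1, and the
    quotient of the two averages is a convex combination of numbers in [c1, c2].

    The coefficients have four sources.
    - The weighted average of a quadratic is its interpolation rule with weights
      [wend 1], [wmid], [wend (-1)] ([wt_avg_interpolation]). The hypothesis
      [gamma_bounds] says exactly that the two end weights are positive, and the
      middle one is the average of a bubble function ([wmin_gt0]).
    - The numerical flux is a difference operator in the six nodal values next to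
      an edge ([ref_flux_interpolation]). In the flux difference of a cell,
      the values of the two neighbours get nonnegative coefficients because
      beta0 >= 1, |g| <= 8 beta1 - 1 and beta1 <= 1/4. The values of the cell itself
      get the negative coefficients that the bound on mu compares with the interpolation
      weights.
    - The mixed term is integrated exactly and reduces to values at the corners of
      cells. Its vertical edges contribute only to the two horizontal mesh lines
      that bound the cell, which carry the first and the last node of the rule in y;
      its horizontal edges behave in the same way. On these lines it has the size
      of mu kappa |c| / w_0 relative to the weight w_0 of the node. The excess of
      beta0 over 1 absorbs it for the neighbours, and the summand kappa |c| of the
      bound on mu for the cell itself.
    - The weights of the quadrature rule are nonnegative, and the first one is positive
      and equal to the last one. All three facts follow from test polynomials that
      vanish at all nodes but one ([gl_inner_weight_ge0], [gl_end_weight_gt0],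
      [gl_end_weights_eq]).

    [cell_bounds] is the estimate at one node, [direction_bounds] sums it over the
    nodes of one direction, and [update_bounds] adds the two directions with the
    weights mu_x / mu and mu_y / mu. *)

Set Implicit Arguments.
Unset Strict Implicit.
Unset Printing Implicit Defensive.

Import Order.TTheory GRing.Theory Num.Theory.
Import numFieldNormedType.Exports.

Local Open Scope classical_set_scope.
Local Open Scope ring_scope.

(** * Affine substitution for Lebesgue integrals *)

Section AffineSubstitution.
Context (R : realType).
Implicit Types (c k a b : R).
Local Notation lm := (@lebesgue_measure R).

Definition aff c k (t : R) : R := c + k * t.

Lemma measurable_aff c k :
  measurable_fun setT (aff c k : measurableTypeR R -> measurableTypeR R).
Proof. by apply: measurable_funD => //; apply: measurable_funM. Qed.

Lemma aff_preimage_itv c k a b (ba bb : bool) : 0 < k ->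
  aff c k @^-1` [set` Interval (BSide ba a) (BSide bb b)] =
  [set` Interval (BSide ba ((a - c) / k)) (BSide bb ((b - c) / k))].
Proof.
move=> k0; apply/seteqP; split=> x /=; rewrite !in_itv/= /aff;
  by rewrite lteif_pdivrMr// lteif_pdivlMr// lteifBlDl lteifBrDl (mulrC x).
Qed.


(* Packaged as a measure, so that the uniqueness of Lebesgue measure applies. *)
Let scaled c k (k0 : 0 < k) : {measure set (measurableTypeR R) -> \bar R} :=
  mscale (NngNum (ltW k0))
    (measure_function_pushforward__canonical__measure_function_Measure lm
       (measurable_aff c k)).

(** It suffices to compare the two measures on half-open intervals, whose preimages
    are intervals that are k times shorter. *)
Lemma lebesgue_measure_aff c k (k0 : 0 < k) (A : set R) : measurable A ->
  lm A = scaled c k0 A.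
Proof.
apply: lebesgue_measure_unique => _ [[a b]] _ <-.
change (lm `]a, b] = (k%:E * lm (aff c k @^-1` `]a, b]))%E).
rewrite aff_preimage_itv//.
rewrite !lebesgue_measure_itv /=.
rewrite !lte_fin ltr_pM2r ?invr_gt0// ltrD2r.
case: ifP => _; last by rewrite mule0.
by rewrite -EFinD -EFinM -mulrBl opprB addrA subrK mulrC divfK ?gt_eqF.
Qed.

Lemma ge0_integral_aff c k (k0 : 0 < k) (D : set R) (f : R -> \bar R) :
  measurable D -> measurable_fun D f -> (forall x, D x -> 0 <= f x)%E ->
  (\int[lm]_(x in D) f x = k%:E * \int[lm]_(t in aff c k @^-1` D) f (aff c k t))%E.
Proof.
move=> mD mf f0.
rewrite (eq_measure_integral (scaled c k0)); last first.
  by move=> A mA _; exact: lebesgue_measure_aff.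
rewrite ge0_integral_mscale//.
rewrite ge0_integral_pushforward//; last by move=> y /set_mem/f0.
exact: measurable_aff.
Qed.

Lemma measurable_aff_preimage c k (D : set R) :
  measurable D -> measurable (aff c k @^-1` D).
Proof. by move=> mD; rewrite -[X in measurable X]setTI; exact: measurable_aff. Qed.

Lemma integrable_aff c k (D : set R) (f : R -> \bar R) : 0 < k ->
  measurable D -> lm.-integrable D f ->
  lm.-integrable (aff c k @^-1` D) (f \o aff c k).
Proof.
move=> k0 mD /integrableP[mf foo]; apply/integrableP; split.
  apply: (measurable_comp mD) => //; first by move=> _ [t Dt <-].
  apply: measurable_funS (measurable_aff c k) => //.
move: foo; rewrite (ge0_integral_aff c k0)//; last first.
  exact: measurableT_comp.
rewrite !ltey; apply: contra => /eqP ->.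
by rewrite gt0_muley// lte_fin.
Qed.

(** Substitution for an integrand that is merely integrable, as the weight of the
    scheme is: the positive and negative parts are transported separately, and the
    integrability of the pulled back function makes the difference meaningful. *)
Lemma integral_aff c k (D : set R) (f : R -> \bar R) : 0 < k ->
  measurable D -> lm.-integrable D f ->
  (\int[lm]_(x in D) f x = k%:E * \int[lm]_(t in aff c k @^-1` D) f (aff c k t))%E.
Proof.
move=> k0 mD fi; have mDk := measurable_aff_preimage c k mD.
have gi : lm.-integrable (aff c k @^-1` D) (fun t => f (aff c k t)).
  exact: (integrable_aff c k0 mD fi).
rewrite [LHS]integralE [in RHS]integralE muleBr//; last first.
  rewrite fin_num_adde_defl// fin_numN.
  exact: integrable_neg_fin_num.
have mf : measurable_fun D f by case/integrableP: fi.
have := ge0_integral_aff c k0 mD (measurable_funepos mf) (fun x _ => funepos_ge0 f x).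
have := ge0_integral_aff c k0 mD (measurable_funeneg mf) (fun x _ => funeneg_ge0 f x).
move=> -> ->.
by rewrite !unlock.
Qed.

Lemma Rintegral_aff c k (D : set R) (f : R -> R) : 0 < k ->
  measurable D -> lm.-integrable D (EFin \o f) ->
  \int[lm]_(x in D) f x = k * \int[lm]_(t in aff c k @^-1` D) f (aff c k t).
Proof.
move=> k0 mD fi; rewrite /Rintegral (integral_aff c k0 mD fi)//.
rewrite fineM//; apply: integrable_fin_num.
  exact: measurable_aff_preimage.
exact: (integrable_aff c k0 mD fi).
Qed.

Lemma aff_preimage_segment c k : 0 < k ->
  aff c k @^-1` `[c - k, c + k] = `[(-1 : R), 1]%classic.
Proof.
move=> k0; rewrite aff_preimage_itv//.
have -> : (c - k - c) / k = -1 by field; rewrite gt_eqF.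
by have -> : (c + k - c) / k = 1 by field; rewrite gt_eqF.
Qed.

End AffineSubstitution.

(** * Polynomials and positive functions on a segment *)

Section SegmentIntegrals.
Context (R : realType).
Implicit Types (a b : R) (P : {poly R}).
Local Notation lm := (@lebesgue_measure R).

(** A nonnegative function with zero integral vanishes almost everywhere, while here
    it is nonzero off the null set [F] in a segment of positive length. The set [F]
    allows for the zeros of test polynomials. *)
Lemma Rintegral_gt0 (f : R -> R) a b (F : set R) : a < b ->
  lm.-integrable `[a, b] (EFin \o f) ->
  (forall x, a <= x <= b -> 0 <= f x) ->
  countable F -> (forall x, a <= x <= b -> ~ F x -> f x != 0) ->
  0 < \int[lm]_(x in `[a, b]) f x.
Proof.
move=> ab fi f0 cF fF; rewrite lt_neqAle; apply/andP; split; last first.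
  by apply: Rintegral_ge0 => x /=; rewrite in_itv; exact: f0.
apply/negP => /eqP If0.
have mf : measurable_fun `[a, b] (EFin \o f) by case/integrableP: fi.
have [N [mN N0 subN]] : ae_eq lm `[a, b]%classic (EFin \o f) (cst 0%E).
  apply: (iffLR (ae_eq_integral_abs lm (measurable_itv _) mf)).
  transitivity (\int[lm]_(x in `[a, b]) (EFin \o f) x)%E.
    by apply: eq_integral => x; rewrite inE/= in_itv/= => /f0 ?; rewrite ger0_norm.
  by rewrite -[LHS]fineK ?integrable_fin_num//; congr (_%:E); rewrite [RHS]If0.
have sub : `[a, b] `<=` N `|` F.
  move=> x xab; have [Fx|nFx] := pselect (F x); [by right|left].
  apply: subN => /= /(_ xab) [fx0]; move: xab; rewrite /= in_itv/= => xab.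
  by move/eqP : (fF x xab nFx).
have mF : measurable F by exact: countable_measurable.
have : (lm `[a, b] <= lm N + lm F)%E.
  have mI : measurable `[a, b]%classic by exact: measurable_itv.
  have := le_measure lm (mem_set mI) (mem_set (measurableU _ _ mN mF)) sub.
  by move=> /le_trans; apply; exact: measureU2.
rewrite N0 (countable_lebesgue_measure0 cF) adde0 lebesgue_measure_itv/= lte_fin ab.
by rewrite -EFinD lee_fin subr_le0 leNgt ab.
Qed.

Lemma integrable_horner P a b : lm.-integrable `[a, b] (EFin \o horner P).
Proof.
apply: continuous_compact_integrable; first exact: segment_compact.
by apply: continuous_subspaceT; exact: continuous_horner.
Qed.

Lemma integrable_mul_horner (N : R -> R) P a b :
  lm.-integrable `[a, b] (EFin \o N) ->
  lm.-integrable `[a, b] (EFin \o (fun x => N x * P.[x])).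
Proof.
move=> Ni.
have -> : EFin \o (fun x => N x * P.[x]) = ((EFin \o N) \* (EFin \o horner P))%E.
  by apply/funext => x /=; rewrite EFinM.
apply: integrableMl => //.
  apply: subspace_continuous_measurable_fun => //.
  by apply: continuous_subspaceT; exact: continuous_horner.
have /compact_bounded[M [_ mrt]] := continuous_compact
  (continuous_subspaceT (@continuous_horner R P)) (@segment_compact R a b).
exists M; split; rewrite ?num_real // => B MB x abx.
by apply: (mrt _ MB); exists x.
Qed.

Lemma Rintegral_deriv P a b : a < b ->
  \int[lm]_(x in `[a, b]) P^`().[x] = P.[b] - P.[a].
Proof.
move=> ab; rewrite /Rintegral (@continuous_FTC2 _ _ (horner P))//.
- by apply: continuous_subspaceT; exact: continuous_horner.
- split.
  + by move=> x _; exact: derivable_horner.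
  + by apply: cvg_at_right_filter; exact: continuous_horner.
  + by apply: cvg_at_left_filter; exact: continuous_horner.
- by move=> x _; rewrite derivE.
Qed.

Lemma Rintegral_horner_opp P :
  \int[lm]_(x in `[-1 : R, 1]) (P \Po - 'X).[x]
  = \int[lm]_(x in `[-1 : R, 1]) P.[x].
Proof.
have le11 : -1 <= 1 :> R by lra.
have := @integration_by_substitution_oppr R (horner P) (-1) 1 le11.
rewrite opprK /Rintegral => ->; last first.
  by apply: continuous_subspaceT; exact: continuous_horner.
by congr fine; apply: eq_integral => x _ /=; rewrite horner_comp !hornerE.
Qed.

End SegmentIntegrals.

(** * Gauss-Lobatto weights *)

Section GaussLobatto.
Context (R : realType) (l : nat) (z w : nat -> R).
Hypothesis GL : gauss_lobatto l.+3 z w.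
Local Notation lm := (@lebesgue_measure R).

Let z0 : z 0%N = -1. Proof. by case: GL. Qed.
Let zL : z l.+2 = 1. Proof. by case: GL. Qed.
Let z_lt s t : (s < t < l.+3)%N -> z s < z t.
Proof. by case: GL => _ _ + _; exact. Qed.

Lemma gl_node_itv s : (s < l.+3)%N -> -1 <= z s <= 1.
Proof.
move=> sL; rewrite -{1}z0 -zL; apply/andP; split.
  by case: s sL => [//|s] sL; apply/ltW/z_lt.
by case: (ltngtP s l.+2) => [sl|ls|->//]; [apply/ltW/z_lt; lia|lia].
Qed.

Let z_neq s t : (s < l.+3)%N -> (t < l.+3)%N -> s != t -> z s - z t != 0.
Proof.
move=> sL tL; rewrite neq_ltn subr_eq0 => /orP[] st.
  by rewrite lt_eqF// z_lt// st.
by rewrite gt_eqF// z_lt// st.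
Qed.

(** For [s = 0] no factor is left out. *)
Definition interior_nodal s : {poly R} :=
  \prod_(1 <= t < l.+2 | t != s) ('X - (z t)%:P).

Lemma horner_interior_nodal s x :
  (interior_nodal s).[x] = \prod_(1 <= t < l.+2 | t != s) (x - z t).
Proof. by rewrite horner_prod; apply: eq_bigr => t _; rewrite !hornerE. Qed.

Lemma size_interior_nodal s :
  size (interior_nodal s) = (l.+2 - (0 < s < l.+2))%N.
Proof.
rewrite /interior_nodal -big_filter size_prod_XsubC size_filter /index_iota subn1 /=.
have := count_predC (pred1 s) (iota 1 l.+1).
rewrite count_uniq_mem ?iota_uniq// mem_iota size_iota add1n ltnS => E.
rewrite (eq_count (a2 := predC (pred1 s)))//.
by case: (0 < s < l.+2)%N E => /=; lia.
Qed.

Lemma interior_nodal_node s t : (s < l.+3)%N -> (0 < t < l.+2)%N -> t != s ->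
  (interior_nodal s).[z t] = 0.
Proof.
move=> sL tl ts; rewrite horner_interior_nodal; apply/eqP.
rewrite prodf_seq_eq0; apply/hasP; exists t; first by rewrite mem_index_iota.
by rewrite ts subrr eqxx.
Qed.

Lemma interior_nodal_neq0 s t : (t < l.+3)%N ->
  (t == s) || ~~ (0 < t < l.+2)%N -> (interior_nodal s).[z t] != 0.
Proof.
move=> tL ts; rewrite horner_interior_nodal prodf_seq_neq0.
apply/allP => r; rewrite mem_index_iota => rl; apply/implyP => rs.
by apply: z_neq => //; lia.
Qed.

Lemma interior_nodal_off_nodes s x :
  ~ range z x -> (interior_nodal s).[x] != 0.
Proof.
move=> nx; rewrite horner_interior_nodal prodf_seq_neq0.
apply/allP => t _; apply/implyP => _.
by rewrite subr_eq0; apply/eqP => xt; apply: nx; exists t.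
Qed.

(* The rule with l + 3 nodes is exact for polynomials of size at most 2 l + 4. *)
Let size_test_poly (u p q : {poly R}) m n : (size u <= m.+1)%N ->
  (size p <= n.+1)%N -> (size q <= n.+1)%N -> (size (u * (p * q))%R <= m + n.*2 + 1)%N.
Proof.
move=> su sp sq; rewrite (leq_trans (size_polyMleq _ _))//.
have := size_polyMleq p q; move: (size u) (size p) (size q) (size (p * q)) su sp sq => *; lia.
Qed.

Lemma gl_weight s (p : {poly R}) : (s < l.+3)%N ->
  (size p <= l.*2 + 4)%N ->
  (forall t, (t < l.+3)%N -> t != s -> p.[z t] = 0) ->
  w s * p.[z s] = 1 / 2 * \int[lm]_(x in `[-1 : R, 1]) p.[x].
Proof.
move=> sL sp p0; case: GL => _ _ _ /(_ p) <-; last by lia.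
rewrite (bigD1 (Ordinal sL))//= big1 ?addr0// => t ts.
by rewrite p0 ?mulr0// -val_eqE.
Qed.

Lemma gl_weight_ge0 s (p : {poly R}) : (s < l.+3)%N ->
  (size p <= l.*2 + 4)%N ->
  (forall t, (t < l.+3)%N -> t != s -> p.[z t] = 0) ->
  0 < p.[z s] -> (forall x, -1 <= x <= 1 -> 0 <= p.[x]) -> 0 <= w s.
Proof.
move=> sL sp p0 ps pge0; rewrite -(pmulr_lge0 _ ps) (gl_weight sL sp p0).
by rewrite mulr_ge0// Rintegral_ge0// => x; rewrite /= in_itv/=; exact: pge0.
Qed.

(** The test polynomial (1 - x^2) times the square of the nodal polynomial without
    the factor of z_s has degree 2 l + 2, one less than the exactness allows. *)
Lemma gl_inner_weight_ge0 s : (0 < s < l.+2)%N -> 0 <= w s.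
Proof.
move=> sl; have sL : (s < l.+3)%N by lia.
pose p := (1 - 'X^2) * interior_nodal s ^+ 2 : {poly R}.
have pE x : p.[x] = (1 - x ^+ 2) * (interior_nodal s).[x] ^+ 2.
  by rewrite /p !hornerE /=; ring.
apply: (@gl_weight_ge0 s p) => //.
- have s1 : (size (1 - 'X^2 : {poly R})%R <= 3)%N.
    by rewrite (leq_trans (size_polyD _ _))// size_polyN size_polyXn size_poly1.
  rewrite (leq_trans (size_test_poly (n := l) s1 _ _))//;
    by [rewrite size_interior_nodal sl; lia|lia].
- move=> t tL ts; rewrite pE.
  case: (posnP t) => [->|t0]; first by rewrite z0; ring.
  have [tl|] := ltnP t l.+2; first by rewrite interior_nodal_node ?t0//; ring.
  by move=> lt; have -> : t = l.+2 by [lia]; rewrite zL; ring.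
- rewrite pE pmulr_lgt0.
    have zs0 : z 0%N < z s by apply: z_lt; lia.
    have zsL : z s < z l.+2 by apply: z_lt; lia.
    by move: zs0 zsL; rewrite z0 zL; nra.
  by rewrite exprn_even_gt0//= interior_nodal_neq0 ?eqxx.
- move=> x x1; rewrite pE mulr_ge0 ?sqr_ge0//; nra.
Qed.

Let full_node t : (t < l.+3)%N -> t != 0%N -> t != l.+2 ->
  (interior_nodal 0).[z t] = 0.
Proof. by move=> tL t0 tl; apply: interior_nodal_node => //; lia. Qed.

(** The test polynomial is (1 - x) q(x)^2, where q vanishes at the interior nodes. *)
Lemma gl_end_weight_gt0 : 0 < w 0%N.
Proof.
pose p := (1 - 'X) * interior_nodal 0 ^+ 2 : {poly R}.
have pE x : p.[x] = (1 - x) * (interior_nodal 0).[x] ^+ 2.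
  by rewrite /p !hornerE /=; ring.
have sp : (size p <= l.*2 + 4)%N.
  have s1 : (size (1 - 'X : {poly R})%R <= 2)%N.
    by rewrite (leq_trans (size_polyD _ _))// size_polyN size_polyX size_poly1.
  rewrite (leq_trans (size_test_poly (n := l.+1) s1 _ _))//;
    by [rewrite size_interior_nodal|lia].
have p0 t : (t < l.+3)%N -> t != 0%N -> p.[z t] = 0.
  move=> tL t0; rewrite pE.
  have [->|tl] := eqVneq t l.+2; first by rewrite zL; ring.
  by rewrite full_node//; ring.
have pge0 x : -1 <= x <= 1 -> 0 <= p.[x].
  by move=> x1; rewrite pE mulr_ge0 ?sqr_ge0//; lra.
have ps : 0 < p.[z 0%N].
  rewrite pE pmulr_rgt0 ?z0 ?opprK//.
  by rewrite -z0 exprn_even_gt0//= interior_nodal_neq0 ?eqxx.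
rewrite -(pmulr_lgt0 _ ps) (gl_weight _ sp p0)//.
apply: mulr_gt0; first by lra.
have lt11 : -1 < 1 :> R by lra.
apply: (Rintegral_gt0 (F := range z) lt11 _ pge0).
- exact: integrable_horner.
- exact: card_image_le.
move=> x x1 xz; rewrite pE mulf_neq0 ?expf_neq0 ?interior_nodal_off_nodes//.
by rewrite subr_eq0; apply/eqP => x1'; apply: xz; exists l.+2; rewrite ?zL.
Qed.

(** With q as above, (1 - x) q(x) q(-x) isolates the first node and
    (1 + x) q(x) q(-x) the last one. The two polynomials are reflections of each
    other, so they have the same integral, and their values at the isolated nodes
    are both 2 q(1) q(-1). This avoids any appeal to the symmetry of the nodes. *)
Lemma gl_end_weights_eq : w l.+2 = w 0%N.
Proof.
pose q := interior_nodal 0; pose q' := q \Po (- 'X).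
have q'E x : q'.[x] = q.[- x] by rewrite horner_comp !hornerE.
have sq' : size q' = size q.
  by rewrite size_comp_poly2// size_polyN size_polyX.
have sp (s : R) : (size ((1 + s *: 'X) * (q * q'))%R <= l.*2 + 4)%N.
  have s1 : (size (1 + s *: 'X : {poly R})%R <= 2)%N.
    rewrite (leq_trans (size_polyD _ _))// geq_max size_poly1/=.
    by rewrite (leq_trans (size_scale_leq _ _))// size_polyX.
  rewrite (leq_trans (size_test_poly (n := l.+1) s1 _ _))//;
    by [rewrite ?sq' size_interior_nodal|lia].
have qn t : (t < l.+3)%N -> t != 0%N -> t != l.+2 -> q.[z t] = 0.
  exact: full_node.
have pE (s : R) x :
    ((1 + s *: 'X) * (q * q')).[x] = (1 + s * x) * (q.[x] * q.[- x]).
  by rewrite !hornerM hornerD hornerZ q'E !hornerE.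
have E0 := @gl_weight 0%N _ isT (sp (-1)).
have EL := @gl_weight l.+2 _ (ltnSn _) (sp 1).
have qq : q.[1] * q.[-1] != 0.
  by rewrite mulf_neq0// /q; [rewrite -zL|rewrite -z0]; apply: interior_nodal_neq0; lia.
have E : w 0%N * ((1 + -1 *: 'X) * (q * q')).[z 0%N] =
         w l.+2 * ((1 + 1 *: 'X) * (q * q')).[z l.+2].
  rewrite E0 ?EL; first last.
  - move=> t tL t0; rewrite pE; have [->|tl] := eqVneq t l.+2.
      by rewrite zL; ring.
    by rewrite qn//; ring.
  - move=> t tL tl; rewrite pE; have [->|t0] := eqVneq t 0%N.
      by rewrite z0; ring.
    by rewrite qn//; ring.
  congr (_ * _); rewrite -Rintegral_horner_opp; apply: eq_Rintegral => x _.
  by rewrite horner_comp hornerN hornerX !pE opprK; ring.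
move: E; rewrite !pE z0 zL opprK => E.
have qq2 : 2 * (q.[1] * q.[-1]) != 0 by rewrite mulf_neq0.
apply: (mulIf qq2); transitivity (w 0%N * ((1 + - 1 * -1) * (q.[-1] * q.[1]))).
  by rewrite E; ring.
by ring.
Qed.
End GaussLobatto.

(** * Quadratics on the reference cell *)

Section ReferenceCell.
Context (R : realType).
Implicit Types (p q r : {poly R}) (N : R -> R) (g : R).
Local Notation lm := (@lebesgue_measure R).

Definition wt_avg N (phi : R -> R) : R :=
  1 / 2 * \int[lm]_(t in `[(-1 : R), 1]) (N t * phi t).

(** The numerical flux, multiplied by the mesh size, between the cells that carry
    [p] (left) and [q] (right), in the reference coordinate of each cell: a
    derivative in x is 2 / h times a reference derivative, whence the coefficients 1
    in front of the first derivatives and 4 beta1 in front of the second ones. *)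
Definition ref_flux (beta0 beta1 : R) p q : R :=
  beta0 * (q.[-1] - p.[1]) + (p^`().[1] + q^`().[-1])
  + 4 * beta1 * (q^`()^`().[-1] - p^`()^`().[1]).

(** The mean of the traces on the right edge of the cell of [p] minus the mean on
    its left edge; [q] and [r] live on the right and left neighbours. *)
Definition mean_diff p q r : R := (q.[-1] + p.[1] - p.[-1] - r.[1]) / 2.

Lemma quadratic_horner p t : (size p <= 3)%N ->
  p.[t] = p`_0 + p`_1 * t + p`_2 * t ^+ 2.
Proof.
move=> sp; rewrite (horner_coef_wide _ sp) !big_ord_recr big_ord0 /=.
by rewrite add0r expr0 mulr1 expr1.
Qed.

Lemma quadratic_derivE p : (size p <= 3)%N ->
  p^`() = (p`_1)%:P + (2 * p`_2) *: 'X.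
Proof.
move=> sp; apply/polyP => i; rewrite coef_deriv coefD coefC coefZ coefX.
case: i => [|[|i]] /=; rewrite ?mulr0 ?mulr1 ?addr0 ?add0r ?mulr_natl//.
by rewrite nth_default ?mul0rn//; apply: leq_trans sp _.
Qed.

Lemma quadratic_deriv p t : (size p <= 3)%N -> p^`().[t] = p`_1 + 2 * p`_2 * t.
Proof. by move=> sp; rewrite quadratic_derivE// !hornerE. Qed.

Lemma quadratic_deriv2 p t : (size p <= 3)%N -> p^`()^`().[t] = 2 * p`_2.
Proof. by move=> sp; rewrite (quadratic_derivE sp) derivD derivC derivZ derivX !hornerE. Qed.

(** All weights of the scheme are averages of quadratics, so that they are linear
    in the three moments of the weight function. *)
Lemma wt_avg_quadratic N (a b c : R) : lm.-integrable `[-1, 1] (EFin \o N) ->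
  wt_avg N (fun t => a + b * t + c * t ^+ 2) =
  a * wt_avg N (fun t => 1) + b * wt_avg N id + c * wt_avg N (fun t => t ^+ 2).
Proof.
move=> Ni.
have NI p : lm.-integrable `[-1, 1] (EFin \o (fun t => N t * p.[t])).
  exact: integrable_mul_horner.
have E p phi : (forall t, phi t = p.[t]) ->
    wt_avg N phi = 1 / 2 * \int[lm]_(t in `[(-1 : R), 1]) (N t * p.[t]).
  by move=> pE; congr (_ * _); apply: eq_Rintegral => t _; rewrite pE.
rewrite (E (a *: 1 + (b *: 'X + c *: 'X^2))); last by move=> t; rewrite !hornerE.
rewrite (E 1 (fun=> 1)); last by move=> t; rewrite hornerE.
rewrite (E 'X id); last by move=> t; rewrite hornerE.
rewrite (E 'X^2 (fun t => t ^+ 2)); last by move=> t; rewrite hornerXn.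
under eq_Rintegral => t _.
  rewrite hornerD mulrDr hornerD mulrDr !hornerZ !(mulrCA (N t)); over.
rewrite /=.
have IZ d p : lm.-integrable `[-1, 1] (EFin \o (fun t => d * (N t * p.[t]))).
  apply: eq_integrable (NI (d *: p)) => // t _ /=.
  by rewrite hornerZ mulrCA.
rewrite RintegralD//; last first.
  apply: eq_integrable (NI (b *: 'X + c *: 'X^2)) => // t _ /=.
  by rewrite hornerD !hornerZ mulrDr !(mulrCA (N t)).
by rewrite RintegralD// !RintegralZl//; ring.
Qed.

Section Weight.
Variable N : R -> R.
Hypothesis Ni : lm.-integrable `[-1, 1] (EFin \o N).
Hypothesis N_gt0 : forall t, -1 <= t <= 1 -> 0 < N t.

Local Notation m0 := (wt_avg N (fun t => 1)).
Local Notation m1 := (wt_avg N id).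
Local Notation m2 := (wt_avg N (fun t => t ^+ 2)).

Let wt_avgE phi a b c : (forall t, phi t = a + b * t + c * t ^+ 2) ->
  wt_avg N phi = a * m0 + b * m1 + c * m2.
Proof. by move=> /funext ->; exact: wt_avg_quadratic. Qed.

Let wt_avg_horner p : (size p <= 3)%N ->
  wt_avg N (horner p) = p`_0 * m0 + p`_1 * m1 + p`_2 * m2.
Proof. by move=> sp; apply: wt_avgE => t; exact: quadratic_horner. Qed.

Let wt_avg_gt0 a b c :
  (forall t, -1 <= t <= 1 -> 0 <= a + b * t + c * t ^+ 2) ->
  (forall t, -1 < t < 1 -> a + b * t + c * t ^+ 2 != 0) ->
  0 < a * m0 + b * m1 + c * m2.
Proof.
move=> ge0 neq0; rewrite -wt_avg_quadratic// /wt_avg mulr_gt0//.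
have lt11 : -1 < 1 :> R by lra.
have f0 t : -1 <= t <= 1 -> 0 <= N t * (a + b * t + c * t ^+ 2).
  by move=> t1; rewrite mulr_ge0 ?ge0// ltW// N_gt0.
apply: (Rintegral_gt0 (F := [set -1; 1]) lt11 _ f0).
- pose p := a *: 1 + (b *: 'X + c *: 'X^2) : {poly R}.
  apply: eq_integrable (integrable_mul_horner p Ni) => // t _ /=.
  by rewrite /p !hornerE.
- exact: finite_set_countable.
move=> t /[dup] t1 /andP[]; rewrite !le_eqVlt.
case/predU1P => [<- _ []|lt1]; first by left.
case/predU1P => [-> []|lt2 _]; first by right.
by rewrite mulf_neq0 ?neq0 ?lt1// gt_eqF// N_gt0.
Qed.

Lemma wt_avg1_gt0 : 0 < m0.
Proof.
have -> : m0 = 1 * m0 + 0 * m1 + 0 * m2 by ring.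
by apply: wt_avg_gt0 => t _; rewrite !mul0r !addr0.
Qed.

Let avg_bubble_gt0 : 0 < m0 - m2.
Proof.
have -> : m0 - m2 = 1 * m0 + 0 * m1 + -1 * m2 by ring.
apply: wt_avg_gt0 => t t1; first by nra.
by apply/eqP; nra.
Qed.

Lemma wend1E g : wend (wt_avg N) 1 g = (g * m0 - (1 + g) * m1 + m2) / (2 * (1 + g)).
Proof.
rewrite /wend (@wt_avgE _ g (- (1 + g)) 1) ?mul1r ?mulNr//.
by move=> t; ring.
Qed.

Lemma wendN1E g :
  wend (wt_avg N) (-1) g = (- g * m0 + (1 - g) * m1 + m2) / (2 * (1 - g)).
Proof.
rewrite /wend (@wt_avgE _ (- g) (1 - g) 1) ?mul1r ?mulN1r//.
by move=> t; ring.
Qed.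

Lemma wmidE g : wmid (wt_avg N) g = (m0 - m2) / (1 - g ^+ 2).
Proof.
rewrite /wmid (@wt_avgE _ 1 0 (-1)) ?mul1r ?mul0r ?addr0 ?mulN1r//.
by move=> t; ring.
Qed.

Lemma wt_avg_interpolation g p : 1 - g != 0 -> 1 + g != 0 -> (size p <= 3)%N ->
  wt_avg N (horner p) =
  wend (wt_avg N) 1 g * p.[-1] + wmid (wt_avg N) g * p.[g]
  + wend (wt_avg N) (-1) g * p.[1].
Proof.
move=> gm gp sp; rewrite wend1E wendN1E wmidE wt_avg_horner// !quadratic_horner//.
have -> : 1 - g ^+ 2 = (1 - g) * (1 + g) by ring.
by field; rewrite gm gp.
Qed.

Section GammaBounds.
Variable g : R.
Hypothesis g_bounds : gamma_bounds (wt_avg N) g.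

Let g_lower : m1 - m2 < g * (m0 - m1).
Proof.
have [+ _] := g_bounds.
rewrite (@wt_avgE _ 0 1 (-1)); last by move=> t; ring.
rewrite (@wt_avgE (fun t => 1 - t) 1 (-1) 0); last by move=> t; ring.
rewrite ltr_pdivrMr; first by lra.
by apply: wt_avg_gt0 => t t1; [lra|apply/eqP; lra].
Qed.

Let g_upper : g * (m0 + m1) < m1 + m2.
Proof.
have [_] := g_bounds.
rewrite (@wt_avgE _ 0 1 1); last by move=> t; ring.
rewrite (@wt_avgE (fun t => 1 + t) 1 1 0); last by move=> t; ring.
rewrite ltr_pdivlMr; first by lra.
by apply: wt_avg_gt0 => t t1; [lra|apply/eqP; lra].
Qed.

(** A weighted mean of t against (1 + t) N(t) dt is less than 1, a mean of t against
    (1 - t) N(t) dt is greater than -1, and these means are the two bounds of g. *)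
Lemma gamma_bounds_lt1 : -1 < g < 1.
Proof.
have mp : 0 < m0 + m1.
  have -> : m0 + m1 = 1 * m0 + 1 * m1 + 0 * m2 by ring.
  by apply: wt_avg_gt0 => t t1; [lra|apply/eqP; lra].
have mm : 0 < m0 - m1.
  have -> : m0 - m1 = 1 * m0 + -1 * m1 + 0 * m2 by ring.
  by apply: wt_avg_gt0 => t t1; [lra|apply/eqP; lra].
have := avg_bubble_gt0; have := g_lower; have := g_upper; nra.
Qed.

(** The numerators of the end weights are g <1 - t> - <t - t^2> and
    <t + t^2> - g <1 + t>, so that each side of [gamma_bounds] is the positivity of
    one of them. *)
Lemma wmin_gt0 : 0 < wmin (wt_avg N) g.
Proof.
have /andP[g1 g2] := gamma_bounds_lt1.
rewrite /wmin !lt_min wend1E wendN1E wmidE !divr_gt0//;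
  have := g_lower; have := g_upper; by [nra|lra].
Qed.
End GammaBounds.
End Weight.

(** Differentiating the interpolation polynomial turns the flux into a difference
    operator whose coefficients have a sign: those of [q.[-1]], [q.[g]], [q.[1]]
    are nonnegative and those of [p.[-1]], [p.[g]], [p.[1]] are nonpositive as soon
    as beta0 >= 1, |g| <= 8 beta1 - 1 and beta1 <= 1/4. *)
Lemma ref_flux_interpolation beta0 beta1 g p q :
  1 - g != 0 -> 1 + g != 0 -> (size p <= 3)%N -> (size q <= 3)%N ->
  ref_flux beta0 beta1 p q =
  (beta0 + (8 * beta1 - 3 - g) / (2 * (1 + g))) * q.[-1]
  + (2 - 8 * beta1) / ((1 - g) * (1 + g)) * (q.[g] - p.[g])
  + (8 * beta1 - 1 - g) / (2 * (1 - g)) * q.[1]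
  - (8 * beta1 - 1 + g) / (2 * (1 + g)) * p.[-1]
  - (beta0 + (8 * beta1 - 3 + g) / (2 * (1 - g))) * p.[1].
Proof.
move=> gm gp sp sq; rewrite /ref_flux !quadratic_deriv2// !quadratic_deriv//.
rewrite !(quadratic_horner _ sp) !(quadratic_horner _ sq).
by field; rewrite gm gp.
Qed.

(* The quantity subtracted from the weight of the end -1 (s = g) or 1 (s = - g),
   bounded by means of G, a common bound of |g| in both directions. *)
Let own_end_coef (beta0 beta1 ma G s : R) : 0 <= ma -> beta1 <= 1 / 4 ->
  -1 < s -> s <= G ->
  ma * (beta0 + (8 * beta1 - 2) / (1 + s)) <=
  ma * (beta0 + (8 * beta1 - 2) / (1 + G)).
Proof.
move=> ma0 b4 s1 sG; rewrite ler_wpM2l// lerD2l ler_wnM2l//; first by lra.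
by rewrite lef_pV2 ?posrE; lra.
Qed.

(* The margin that pays for the mixed term on the side of the neighbour: the
   derivatives in the flux cost at most one unit of the penalty beta0. *)
Let neighbour_end_coef (beta0 beta1 ma s : R) : 0 <= ma ->
  -1 < s -> - s <= 8 * beta1 - 1 ->
  ma * (beta0 - 1) <= ma * (beta0 + (8 * beta1 - 3 - s) / (2 * (1 + s))).
Proof.
by move=> ma0 s1 sb; rewrite ler_wpM2l// lerD2l ler_pdivlMr; lra.
Qed.

Let own_mid_coef (beta1 ma G s omega : R) : 0 <= ma -> beta1 <= 1 / 4 ->
  - G <= s <= G -> G < 1 ->
  ma * (4 * (1 - 4 * beta1)) <= omega * (1 - G ^+ 2) ->
  ma * (4 * (1 - 4 * beta1)) / ((1 - s) * (1 + s)) <= omega.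
Proof.
move=> ma0 b4 /andP[s1 s2] G1 h; rewrite ler_pdivrMr; last by rewrite mulr_gt0//; lra.
have G2 : 0 < 1 - G ^+ 2 by nra.
have o0 : 0 <= omega.
  by rewrite -(pmulr_lge0 _ G2) (le_trans _ h)// mulr_ge0//; lra.
by apply: (le_trans h); rewrite ler_wpM2l//; nra.
Qed.

(** The middle expression is one line of the scheme, with [ma] for mu times the
    diffusion coefficient and [e] for the mixed term that falls on this line. It is a
    combination of the nine values of [p], [q] and [r] at -1, g, 1. The coefficients
    are nonnegative: for [p] by the two step size conditions, for [q] and [r] by
    the sign of the flux coefficients and the bound on [e]. *)
Lemma cell_bounds N beta0 beta1 g G ma e omega c1 c2 p q r :
  lm.-integrable `[-1, 1] (EFin \o N) -> (forall t, -1 <= t <= 1 -> 0 < N t) ->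
  `|g| <= G -> G < 1 -> `|g| <= 8 * beta1 - 1 -> beta1 <= 1 / 4 -> 0 <= ma ->
  omega <= wmin (wt_avg N) g ->
  ma * (beta0 + (8 * beta1 - 2) / (1 + G)) + `|e| / 2 <= omega ->
  ma * (4 * (1 - 4 * beta1)) <= omega * (1 - G ^+ 2) ->
  `|e| / 2 <= ma * (beta0 - 1) ->
  (size p <= 3)%N -> (size q <= 3)%N -> (size r <= 3)%N ->
  (forall t, t \in [:: -1; g; 1] ->
    [/\ c1 <= p.[t] <= c2, c1 <= q.[t] <= c2 & c1 <= r.[t] <= c2]) ->
  c1 * wt_avg N (fun t => 1)
  <= wt_avg N (horner p)
     + ma * (ref_flux beta0 beta1 p q - ref_flux beta0 beta1 r p)
     + e * mean_diff p q r
  <= c2 * wt_avg N (fun t => 1).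
Proof.
move=> Ni N0; rewrite !ler_norml => gG G1 gb b4 ma0 oW h1 h2 h3 sp sq sr vals.
have /andP[gG1 gG2] := gG; have /andP[gb1 gb2] := gb.
have gm1 : -1 < - g by lra.
have gp1 : -1 < g by lra.
have gm0 : 0 < 1 - g by lra.
have gp0 : 0 < 1 + g by lra.
have gm : 1 - g != 0 by rewrite gt_eqF.
have gp : 1 + g != 0 by rewrite gt_eqF.
have gm2 : - - g <= 8 * beta1 - 1 by rewrite opprK.
have gp2 : - g <= 8 * beta1 - 1 by lra.
have /and3P[w1 w3 w2] : [&& omega <= wend (wt_avg N) 1 g,
    omega <= wend (wt_avg N) (-1) g & omega <= wmid (wt_avg N) g].
  by move: oW; rewrite /wmin !le_min -andbA.
have E1 : wt_avg N (fun t => 1) = wend (wt_avg N) 1 g + wmid (wt_avg N) g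
    + wend (wt_avg N) (-1) g.
  have -> : (fun t : R => 1) = horner 1 by apply/funext => t; rewrite hornerE.
  by rewrite (wt_avg_interpolation Ni gm gp) ?size_poly1// !hornerE.
rewrite E1 (wt_avg_interpolation Ni gm gp sp).
rewrite !(ref_flux_interpolation beta0 beta1 gm gp)//.
move: (wend _ 1 g) (wend _ (-1) g) (wmid _ g) w1 w3 w2 => W1 W3 W2 w1 w3 w2 {oW E1}.
have e2 : - (`|e| / 2) <= e / 2 <= `|e| / 2.
  by rewrite -ler_norml normrM (ger0_norm (_ : 0 <= 2^-1)).
move: (`|e| / 2) h1 h3 e2 => e' h1 h3 /andP[e1 e2].
pose P1 := W1 - ma * (beta0 + (8 * beta1 - 2) / (1 + g)) - e / 2.
pose P2 := W2 - ma * (4 * (1 - 4 * beta1)) / ((1 - g) * (1 + g)).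
pose P3 := W3 - ma * (beta0 + (8 * beta1 - 2) / (1 - g)) + e / 2.
pose Q1 := ma * (beta0 + (8 * beta1 - 3 - g) / (2 * (1 + g))) + e / 2.
pose Q2 := ma * ((2 - 8 * beta1) / ((1 - g) * (1 + g))).
pose Q3 := ma * ((8 * beta1 - 1 - g) / (2 * (1 - g))).
pose R1 := ma * ((8 * beta1 - 1 + g) / (2 * (1 + g))).
pose R3 := ma * (beta0 + (8 * beta1 - 3 + g) / (2 * (1 - g))) - e / 2.
have P1_ge0 : 0 <= P1.
  rewrite /P1 -addrA -opprD subr_ge0 (le_trans _ w1)// (le_trans _ h1)//.
  by rewrite lerD//; exact: own_end_coef.
have P3_ge0 : 0 <= P3.
  rewrite /P3 addrAC subr_ge0 -lerBlDr (le_trans _ w3)// (le_trans _ h1)//.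
  by rewrite lerD//; [apply: own_end_coef; rewrite // lerNl|rewrite lerNl].
have P2_ge0 : 0 <= P2.
  by rewrite /P2 subr_ge0 (le_trans _ w2)//; exact: (own_mid_coef ma0 b4 gG G1 h2).
have Q1_ge0 : 0 <= Q1.
  rewrite /Q1 -lerBlDr sub0r (le_trans _ (neighbour_end_coef beta0 ma0 gp1 gp2))//.
  by rewrite (le_trans _ h3)// lerNl.
have R3_ge0 : 0 <= R3.
  rewrite /R3 subr_ge0 (le_trans e2)// (le_trans h3)//.
  by have := neighbour_end_coef beta0 ma0 gm1 gm2; rewrite opprK.
have Q2_ge0 : 0 <= Q2.
  rewrite mulr_ge0// divr_ge0//; last by rewrite mulr_ge0// ltW.
  by clear -b4; lra.
have Q3_ge0 : 0 <= Q3.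
  by rewrite mulr_ge0// divr_ge0 ?subr_ge0// mulr_ge0// ltW.
have R1_ge0 : 0 <= R1.
  rewrite mulr_ge0// divr_ge0//; last by rewrite mulr_ge0// ltW.
  by rewrite -lerBlDr sub0r.
have [|/andP[p1 p1'] /andP[q1 q1'] /andP[r1 r1']] := vals (-1).
  by rewrite !inE eqxx.
have [|/andP[pg pg'] /andP[qg qg'] /andP[rg rg']] := vals g.
  by rewrite !inE eqxx orbT.
have [|/andP[p3 p3'] /andP[q3 q3'] /andP[r3 r3']] := vals 1.
  by rewrite !inE eqxx !orbT.
set S := (X in _ <= X <= _).
(* The identity for all c contains the fact that the coefficients add up to
   W1 + W2 + W3; the two bounds are its instances at c1 and c2. *)
have E c : S =
   c * (W1 + W2 + W3) + (P1 * (p.[-1] - c) + P2 * (p.[g] - c) + P3 * (p.[1] - c)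
     + (Q1 * (q.[-1] - c) + Q2 * (q.[g] - c) + Q3 * (q.[1] - c))
     + (R1 * (r.[-1] - c) + Q2 * (r.[g] - c) + R3 * (r.[1] - c))).
  by rewrite /S /mean_diff /P1 /P2 /P3 /Q1 /Q2 /Q3 /R1 /R3; field; rewrite gm gp.
apply/andP; split.
  by rewrite (E c1) lerDl !addr_ge0// mulr_ge0// subr_ge0.
rewrite (E c2) gerDl -oppr_ge0 !opprD.
by rewrite !addr_ge0// -mulrN mulr_ge0// opprB subr_ge0.
Qed.
End ReferenceCell.

(** * Summation over the lines of one direction *)

Section Direction.
Context (R : realType) (l : nat) (z w : nat -> R).
Hypothesis GL : gauss_lobatto l.+3 z w.
Local Notation lm := (@lebesgue_measure R).

Lemma gl_weight_nonneg s : (s < l.+3)%N -> 0 <= w s.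
Proof.
move=> sl; have w0 := ltW (gl_end_weight_gt0 GL).
have [->//|s0] := eqVneq s 0%N; have [->|sL] := eqVneq s l.+2.
  by rewrite (gl_end_weights_eq GL).
by apply: (gl_inner_weight_ge0 GL); lia.
Qed.

(** The mixed term [e] lives on the first and the last line only. Dividing it by the
    weight of these nodes distributes it over the sum, with opposite signs, and
    [cell_bounds] applies to every line; this is where the equality of the two end
    weights matters. *)
Lemma direction_bounds (N : nat -> R -> R) (beta0 beta1 g G ma e c1 c2 : R)
    (p q r : nat -> {poly R}) :
  `|g| <= G -> G < 1 -> `|g| <= 8 * beta1 - 1 -> beta1 <= 1 / 4 -> 0 <= ma ->
  `|e / w 0%N| / 2 <= ma * (beta0 - 1) ->
  (forall s, (s < l.+3)%N ->
    [/\ lm.-integrable `[-1, 1] (EFin \o N s),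
        forall t, -1 <= t <= 1 -> 0 < N s t,
        ma * (beta0 + (8 * beta1 - 2) / (1 + G)) + `|e / w 0%N| / 2
          <= wmin (wt_avg (N s)) g
      & ma * (4 * (1 - 4 * beta1)) <= wmin (wt_avg (N s)) g * (1 - G ^+ 2)]) ->
  (forall s, (s < l.+3)%N ->
    [/\ (size (p s) <= 3)%N, (size (q s) <= 3)%N & (size (r s) <= 3)%N]) ->
  (forall s t, (s < l.+3)%N -> t \in [:: -1; g; 1] ->
    [/\ c1 <= (p s).[t] <= c2, c1 <= (q s).[t] <= c2 & c1 <= (r s).[t] <= c2]) ->
  c1 * (\sum_(s < l.+3) w s * wt_avg (N s) (fun t => 1))
  <= \sum_(s < l.+3) w s * (wt_avg (N s) (horner (p s))
       + ma * (ref_flux beta0 beta1 (p s) (q s) - ref_flux beta0 beta1 (r s) (p s)))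
     + e * (mean_diff (p l.+2) (q l.+2) (r l.+2)
            - mean_diff (p 0%N) (q 0%N) (r 0%N))
  <= c2 * (\sum_(s < l.+3) w s * wt_avg (N s) (fun t => 1)).
Proof.
move=> gG G1 gb b4 ma0 h3 hN hsize hval.
pose D s := mean_diff (p s) (q s) (r s).
have w0 := gl_end_weight_gt0 GL.
pose e_ (s : nat) := if s == 0%N then - (e / w 0%N)
  else if s == l.+2 then e / w 0%N else 0.
have e_le s : `|e_ s| / 2 <= `|e / w 0%N| / 2.
  rewrite ler_pM2r// /e_; case: eqP => _; first by rewrite normrN.
  by case: eqP => _ //; rewrite normr0.
set F := fun s : nat => wt_avg (N s) (horner (p s))
  + ma * (ref_flux beta0 beta1 (p s) (q s) - ref_flux beta0 beta1 (r s) (p s)).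
have bnd s : (s < l.+3)%N ->
    c1 * wt_avg (N s) (fun t => 1) <= F s + e_ s * D s
      <= c2 * wt_avg (N s) (fun t => 1).
  move=> sl; have [Ni N0 h1 h2] := hN _ sl; have [sp sq sr] := hsize _ sl.
  apply: (cell_bounds (G := G) (g := g) (omega := wmin (wt_avg (N s)) g)) => //.
  - by rewrite (le_trans _ h1)// lerD2l.
  - exact: le_trans (e_le s) h3.
  - by move=> t; exact: hval.
rewrite -/(D _) -/(D _).
have -> : \sum_(s < l.+3) w s * F s + e * (D l.+2 - D 0%N)
    = \sum_(s < l.+3) w s * (F s + e_ s * D s).
  under [RHS]eq_bigr do rewrite mulrDr.
  rewrite big_split /=; congr (_ + _).
  rewrite big_ord_recl big_ord_recr /= big1 => [|i _]; last first.
    rewrite /e_ /= ifN ?mul0r ?mulr0//.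
    by rewrite /bump /= add1n eqSS; have := ltn_ord i; lia.
  rewrite /e_ /= /bump /= add1n eqxx (gl_end_weights_eq GL).
  by field; rewrite gt_eqF.
rewrite !mulr_sumr; apply/andP; split; apply: ler_sum => s _;
  have /andP[b1 b2] := bnd s (ltn_ord s);
  by rewrite [_ * (w s * _)]mulrCA ler_wpM2l// gl_weight_nonneg.
Qed.
End Direction.

(** * Transport of polynomials to the reference cell *)

Section Pullback.
Context (R : realType).
Implicit Types (P Q : {poly R}) (c h x : R).
Local Notation lm := (@lebesgue_measure R).

(** The polynomial in the reference coordinate of the cell with center [c] and
    width [h]. *)
Definition pullback c h P : {poly R} := P \Po (c%:P + (h / 2) *: 'X).

Lemma horner_pullback c h P t : (pullback c h P).[t] = P.[c + h / 2 * t].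
Proof. by rewrite horner_comp !hornerE. Qed.

Lemma size_pullback c h P : (size P <= 3)%N -> (size (pullback c h P) <= 3)%N.
Proof.
move=> sP; have s2 : (size (c%:P + (h / 2) *: 'X)%R <= 2)%N.
  rewrite (leq_trans (size_polyD _ _))// geq_max (leq_trans (size_polyC_leq1 _))//=.
  by rewrite (leq_trans (size_scale_leq _ _))// size_polyX.
rewrite (leq_trans (size_comp_poly_leq _ _))//.
by rewrite ltnS -[2%N]/(2 * 1)%N leq_mul// -subn1 leq_subLR.
Qed.

Lemma deriv_pullback c h P : (pullback c h P)^`() = (h / 2) *: pullback c h P^`().
Proof.
rewrite /pullback deriv_comp derivD derivC derivZ derivX add0r.
by rewrite -scalerAr mulr1.
Qed.

Lemma flux_pullback beta0 beta1 h cp cq P Q : 0 < h ->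
  h * (beta0 / h * (Q.[cq - h / 2] - P.[cp + h / 2])
       + (Q^`().[cq - h / 2] + P^`().[cp + h / 2]) / 2
       + beta1 * h * (Q^`()^`().[cq - h / 2] - P^`()^`().[cp + h / 2]))
  = ref_flux beta0 beta1 (pullback cp h P) (pullback cq h Q).
Proof.
move=> h0; rewrite /ref_flux !deriv_pullback !derivZ !deriv_pullback !hornerZ.
by rewrite !horner_pullback !mulr1 !mulrN1; field; rewrite gt_eqF.
Qed.

Lemma integrable_reference (M : R -> R) c h : 0 < h ->
  lm.-integrable `[c - h / 2, c + h / 2] (EFin \o M) ->
  lm.-integrable `[-1, 1] (EFin \o (fun t => M (c + h / 2 * t))).
Proof.
move=> h0 Mi; have h2 : 0 < h / 2 by rewrite divr_gt0.
by have := integrable_aff c h2 (measurable_itv _) Mi; rewrite aff_preimage_segment.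
Qed.

Lemma line_average_pullback (M : R -> R) c h P : 0 < h ->
  lm.-integrable `[c - h / 2, c + h / 2] (EFin \o M) ->
  h^-1 * \int[lm]_(x in `[c - h / 2, c + h / 2]) (M x * P.[x])
  = wt_avg (fun t => M (c + h / 2 * t)) (horner (pullback c h P)).
Proof.
move=> h0 Mi; have h2 : 0 < h / 2 by rewrite divr_gt0.
rewrite (Rintegral_aff c h2 (measurable_itv _)); last exact: integrable_mul_horner.
rewrite aff_preimage_segment// mulrA /wt_avg; congr (_ * _).
  by field; rewrite gt_eqF.
by apply: eq_Rintegral => t _; rewrite horner_pullback.
Qed.

Lemma derive1_horner (f : R -> R) P : f =1 horner P -> derive1 f = horner P^`().
Proof. by move=> /funext ->; rewrite derivE. Qed.

Lemma Qpoly_fst k (p : R -> R -> R) y : Qpoly k p ->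
  exists P : {poly R}, (size P <= k.+1)%N /\ forall x, p x y = P.[x].
Proof.
move=> [C pE]; exists (\poly_(s < k.+1) \sum_(t < k.+1) C (inord s) t * y ^+ t).
split=> [|x]; first exact: size_poly.
rewrite pE horner_poly; apply: eq_bigr => s _; rewrite mulr_suml.
by apply: eq_bigr => t _; rewrite inord_val mulrAC.
Qed.

Lemma Qpoly_snd k (p : R -> R -> R) x : Qpoly k p ->
  exists P : {poly R}, (size P <= k.+1)%N /\ forall y, p x y = P.[y].
Proof.
move=> [C pE]; exists (\poly_(t < k.+1) \sum_(s < k.+1) C s (inord t) * x ^+ s).
split=> [|y]; first exact: size_poly.
rewrite pE exchange_big horner_poly; apply: eq_bigr => t _; rewrite mulr_suml.
by apply: eq_bigr => s _; rewrite inord_val.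
Qed.

Lemma Rintegral_mean_derive (f g : R -> R) P Q a b : a < b ->
  f =1 horner P -> g =1 horner Q ->
  \int[lm]_(x in `[a, b]) ((derive1 f x + derive1 g x) / 2)
  = (f b + g b) / 2 - (f a + g a) / 2.
Proof.
move=> ab fP gQ; rewrite (derive1_horner fP) (derive1_horner gQ).
transitivity (\int[lm]_(x in `[a, b]) (2^-1 *: (P + Q))^`().[x]).
  by apply: eq_Rintegral => x _; rewrite derivZ derivD !hornerE mulrC.
by rewrite Rintegral_deriv// !hornerE !fP !gQ; ring.
Qed.

End Pullback.

(** * The terms of the scheme in reference coordinates *)

Section MeshLines.
Context (R : realType) (m : mesh R).
Implicit Types (i : 'I_(nx m)) (j : 'I_(ny m)).
Local Notation lm := (@lebesgue_measure R).

Definition xcenter (i : 'I_(nx m)) : R := (xl i + xr i) / 2.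
Definition ycenter (j : 'I_(ny m)) : R := (yb j + yt j) / 2.

Lemma xlE i : xl i = xcenter i - dx m / 2.
Proof. by rewrite /xcenter /xl /xr -(natr1 i); field. Qed.
Lemma xrE i : xr i = xcenter i + dx m / 2.
Proof. by rewrite /xcenter /xl /xr -(natr1 i); field. Qed.
Lemma ybE j : yb j = ycenter j - dy m / 2.
Proof. by rewrite /ycenter /yb /yt -(natr1 j); field. Qed.
Lemma ytE j : yt j = ycenter j + dy m / 2.
Proof. by rewrite /ycenter /yb /yt -(natr1 j); field. Qed.

Lemma yb_lt_yt j : yb j < yt j.
Proof. by rewrite ybE ytE; have := dy_gt0 m; lra. Qed.
Lemma xl_lt_xr i : xl i < xr i.
Proof. by rewrite xlE xrE; have := dx_gt0 m; lra. Qed.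

Lemma Omega_at i j (s t : R) : -1 <= s <= 1 -> -1 <= t <= 1 ->
  Omega m (xat i s, yat j t).
Proof.
have grid (o h : R) (n : nat) (k : 'I_n) (r : R) : 0 < h -> -1 <= r <= 1 ->
    o <= ((o + k%:R * h) + (o + k.+1%:R * h)) / 2 + h / 2 * r <= o + n%:R * h.
  move=> h0 /andP[r1 r2]; rewrite -natr1.
  have k0 : (0 : R) <= k%:R by exact: ler0n.
  have kn : k%:R + 1 <= n%:R :> R by rewrite natr1 ler_nat.
  have k0h : 0 <= k%:R * h by rewrite mulr_ge0// ltW.
  have knh : (k%:R + 1) * h <= n%:R * h by rewrite ler_pM2r.
  have r1h : h * (-1) <= h * r by rewrite ler_pM2l.
  have r2h : h * r <= h * 1 by rewrite ler_pM2l.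
  by apply/andP; split; lra.
move=> s1 t1; split; rewrite /= in_itv/=; apply: grid => //.
  exact: dx_gt0.
exact: dy_gt0.
Qed.

Variable u : broken m.
Hypothesis Vu : Vh 2 u.

(** The restrictions of [u] on a cell to a horizontal and to a vertical line, as
    polynomials. *)
Definition Xpoly i j y : {poly R} := projT1 (cid (Qpoly_fst y (Vu i j))).
Definition Ypoly i j x : {poly R} := projT1 (cid (Qpoly_snd x (Vu i j))).

Lemma size_Xpoly i j y : (size (Xpoly i j y) <= 3)%N.
Proof. by rewrite /Xpoly; case: cid => P []. Qed.
Lemma horner_Xpoly i j y x : u i j x y = (Xpoly i j y).[x].
Proof. by rewrite /Xpoly; case: cid => P []. Qed.
Lemma size_Ypoly i j x : (size (Ypoly i j x) <= 3)%N.
Proof. by rewrite /Ypoly; case: cid => P []. Qed.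
Lemma horner_Ypoly i j x y : u i j x y = (Ypoly i j x).[y].
Proof. by rewrite /Ypoly; case: cid => P []. Qed.

Lemma horner_dX i j x y : dX u i j x y = (Xpoly i j y)^`().[x].
Proof. by rewrite /dX (derive1_horner (P := Xpoly i j y))// => t; exact: horner_Xpoly. Qed.
Lemma horner_dY i j x y : dY u i j x y = (Ypoly i j x)^`().[y].
Proof. by rewrite /dY (derive1_horner (P := Ypoly i j x))// => t; exact: horner_Ypoly. Qed.
Lemma horner_dXX i j x y : dX (dX u) i j x y = (Xpoly i j y)^`()^`().[x].
Proof. by rewrite {1}/dX (derive1_horner (P := (Xpoly i j y)^`()))// => t; exact: horner_dX. Qed.
Lemma horner_dYY i j x y : dY (dY u) i j x y = (Ypoly i j x)^`()^`().[y].
Proof. by rewrite {1}/dY (derive1_horner (P := (Ypoly i j x)^`()))// => t; exact: horner_dY. Qed.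

Definition Xref i j y : {poly R} := pullback (xcenter i) (dx m) (Xpoly i j y).
Definition Yref i j x : {poly R} := pullback (ycenter j) (dy m) (Ypoly i j x).

Lemma horner_Xref i j y t : (Xref i j y).[t] = u i j (xat i t) y.
Proof. by rewrite horner_pullback horner_Xpoly. Qed.
Lemma horner_Yref i j x t : (Yref i j x).[t] = u i j x (yat j t).
Proof. by rewrite horner_pullback horner_Ypoly. Qed.

Lemma xatN1 i : xat i (-1) = xl i. Proof. by rewrite xlE /xat mulrN1. Qed.
Lemma xat1 i : xat i 1 = xr i. Proof. by rewrite xrE /xat mulr1. Qed.
Lemma yatN1 j : yat j (-1) = yb j. Proof. by rewrite ybE /yat mulrN1. Qed.
Lemma yat1 j : yat j 1 = yt j. Proof. by rewrite ytE /yat mulr1. Qed.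

Variables (M : R -> R -> R) (a b c beta0 beta1 tau : R).

(** The right neighbour is a variable [i'] so that the lemma also covers the left
    edge of a column, whose right neighbour is the column itself, equal to the
    successor of its predecessor but not syntactically so. *)
Lemma fluxX_reference i i' j y : i' = ordS i ->
  dx m * fluxX beta0 beta1 u i j y =
  ref_flux beta0 beta1 (Xref i j y) (Xref i' j y).
Proof.
move=> ->; rewrite /fluxX /jumpX /meanX !horner_Xpoly !horner_dX !horner_dXX xrE !xlE.
by apply: flux_pullback; exact: dx_gt0.
Qed.

Lemma fluxY_reference i j j' x : j' = ordS j ->
  dy m * fluxY beta0 beta1 u i j x =
  ref_flux beta0 beta1 (Yref i j x) (Yref i j' x).
Proof.
move=> ->; rewrite /fluxY /jumpY /meanY !horner_Ypoly !horner_dY !horner_dYY ytE !ybE.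
by apply: flux_pullback; exact: dy_gt0.
Qed.

Lemma lineX_reference i j y :
  lm.-integrable (Icell i) (fun x => (M x y)%:E) ->
  lineX M u i j y = wt_avg (fun t => M (xat i t) y) (horner (Xref i j y)).
Proof.
rewrite /lineX /intI /Icell xlE xrE => Mi.
rewrite -(line_average_pullback _ (dx_gt0 m) Mi); congr (_ * _).
by apply: eq_Rintegral => x _; rewrite horner_Xpoly.
Qed.

Lemma lineY_reference i j x :
  lm.-integrable (Jcell j) (fun y => (M x y)%:E) ->
  lineY M u i j x = wt_avg (fun t => M x (yat j t)) (horner (Yref i j x)).
Proof.
rewrite /lineY /intJ /Jcell ybE ytE => Mi.
rewrite -(line_average_pullback _ (dy_gt0 m) Mi); congr (_ * _).
by apply: eq_Rintegral => y _; rewrite horner_Ypoly.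
Qed.

Let scale_difference (v d x y p q p' q' : R) : d * p = p' -> d * q = q' ->
  v + x * d * (y * p - y * q) = v + x * y * (p' - q').
Proof. by move=> <- <-; ring. Qed.

Lemma H1_reference i j y :
  lm.-integrable (Icell i) (fun x => (M x y)%:E) ->
  H1 M a beta0 beta1 tau u i j y =
  wt_avg (fun t => M (xat i t) y) (horner (Xref i j y))
  + mu m tau * a * (ref_flux beta0 beta1 (Xref i j y) (Xref (ordS i) j y)
                    - ref_flux beta0 beta1 (Xref (ord_pred i) j y) (Xref i j y)).
Proof.
move=> Mi; rewrite /H1 (lineX_reference _ Mi).
apply: scale_difference; first exact: (fluxX_reference j y (erefl (ordS i))).
exact: (fluxX_reference j y (esym (ord_predK i))).
Qed.

Lemma H2_reference i j x :
  lm.-integrable (Jcell j) (fun y => (M x y)%:E) ->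
  H2 M b beta0 beta1 tau u i j x =
  wt_avg (fun t => M x (yat j t)) (horner (Yref i j x))
  + mu m tau * b * (ref_flux beta0 beta1 (Yref i j x) (Yref i (ordS j) x)
                    - ref_flux beta0 beta1 (Yref i (ord_pred j) x) (Yref i j x)).
Proof.
move=> Mi; rewrite /H2 (lineY_reference _ Mi).
apply: scale_difference; first exact: (fluxY_reference i x (erefl (ordS j))).
exact: (fluxY_reference i x (esym (ord_predK j))).
Qed.

(** The mean of a derivative along an edge integrates to the difference of the means
    at the ends of the edge: the mixed term sees only corner values. *)
Lemma intJ_meanX_dY i j :
  intJ j (meanX (dY u) i j) = meanX u i j (yt j) - meanX u i j (yb j).
Proof.
rewrite /intJ /Jcell.
apply: (Rintegral_mean_derive (yb_lt_yt j)) => y; exact: horner_Ypoly.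
Qed.

Lemma intI_meanY_dX i j :
  intI i (meanY (dX u) i j) = meanY u i j (xr i) - meanY u i j (xl i).
Proof.
rewrite /intI /Icell.
apply: (Rintegral_mean_derive (xl_lt_xr i)) => x; exact: horner_Xpoly.
Qed.

Let half_difference (p q r s : R) :
  (p + q - r - s) / 2 = (p + q) / 2 - (r + s) / 2.
Proof. by ring. Qed.

Lemma mean_diff_X i j y :
  mean_diff (Xref i j y) (Xref (ordS i) j y) (Xref (ord_pred i) j y) =
  meanX u i j y - meanX u (ord_pred i) j y.
Proof.
by rewrite /mean_diff !horner_Xref /meanX ord_predK !xatN1 !xat1 half_difference.
Qed.

Lemma mean_diff_Y i j x :
  mean_diff (Yref i j x) (Yref i (ordS j) x) (Yref i (ord_pred j) x) =
  meanY u i j x - meanY u i (ord_pred j) x.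
Proof.
by rewrite /mean_diff !horner_Yref /meanY ord_predK !yatN1 !yat1 half_difference.
Qed.

End MeshLines.

(** * Consequences of the hypotheses on the parameters *)

Section StabilityConstants.
Context (R : realType).

Lemma nonneg_definite_diag (a b c : R) : nonneg_definite a b c -> 0 <= a /\ 0 <= b.
Proof.
by move=> A; split; [have := A 1 0|have := A 0 1]; rewrite !expr2; lra.
Qed.

(** If a diagonal entry vanishes, the quadratic form is affine in one variable with
    slope 2 c, and an affine function bounded below is constant. *)
Lemma nonneg_definite_min0 (a b c : R) :
  nonneg_definite a b c -> Num.min a b = 0 -> c = 0.
Proof.
move=> A ab0; apply/eqP/negPn/negP => c0.
have linear (d : R) : (forall s, 0 <= 2 * c * s + d) -> False.
  move=> /(_ (- (d + 1) / (2 * c))).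
  have -> : 2 * c * (- (d + 1) / (2 * c)) + d = -1 by field.
  by rewrite ler0N1.
have [a0|b0] : a = 0 \/ b = 0.
  by move: ab0; rewrite /Num.min; case: ifP => _ ->; [left|right].
- by apply: (linear b) => s; have := A s 1; rewrite a0 mul0r add0r expr1n !mulr1.
- apply: (linear a) => s; have := A 1 s.
  by rewrite b0 mul0r addr0 expr1n !mulr1 addrC.
Qed.

(** If min(a, b) > 0 this is the hypothesis on beta0. If min(a, b) = 0 the quotient
    in that hypothesis is 0 by convention, but then c = 0. *)
Lemma penalty_dominates_cross (a b c d beta0 kappa w0 : R) :
  nonneg_definite a b c -> 0 < w0 -> Num.min a b <= d ->
  1 + kappa * `|c| / (2 * w0 * Num.min a b) <= beta0 -> 0 < kappa ->
  kappa * `|c| <= 2 * w0 * (d * (beta0 - 1)).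
Proof.
move=> A w0_gt0 abd hb k0; have [a0 b0] := nonneg_definite_diag A.
have m0 : 0 <= Num.min a b by rewrite le_min a0.
have [mE|mN0] := eqVneq (Num.min a b) 0.
  have c0 := nonneg_definite_min0 A mE; move: hb abd.
  rewrite mE c0 normr0 mulr0 mul0r addr0 => hb d0.
  by rewrite !mulr_ge0// ?subr_ge0// ltW.
have mp : 0 < Num.min a b by rewrite lt_def mN0.
have b1 : 0 <= beta0 - 1.
  rewrite subr_ge0 (le_trans _ hb)// lerDl divr_ge0//.
    by rewrite mulr_ge0// ltW.
  by rewrite !mulr_ge0// ltW.
move: hb; rewrite -lerBrDl ler_pdivrMr ?mulr_gt0// => /le_trans; apply.
by rewrite mulrC -!mulrA ler_wpM2l// (ler_wpM2l (ltW w0_gt0))// ler_wpM2r.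
Qed.

Lemma le_quot_oo (x omega p q : R) : 0 < omega -> 0 < p -> 0 <= q ->
  (x%:E <= omega%:E * quot_oo p q)%E -> x * q <= omega * p.
Proof.
move=> o0 p0; rewrite /quot_oo; have [-> _ _|q0 qge0] := eqVneq q 0.
  by rewrite mulr0 mulr_ge0 ?ltW.
have qp : 0 < q by rewrite lt_def q0.
by rewrite -EFinM lee_fin mulrA ler_pdivlMr.
Qed.

Lemma quot_oo_gt0 (p q : R) : 0 < p -> 0 <= q -> (0 < quot_oo p q)%E.
Proof.
move=> p0 qge0; rewrite /quot_oo; have [//|q0] := eqVneq q 0.
by rewrite lte_fin divr_gt0// lt_def q0.
Qed.

(** The three hypotheses of [cell_bounds] on the mixed term and the step size, from
    the bounds that [mu_bound] and beta0 provide; [d] is the diffusion coefficient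
    of one direction, [D] the larger one, and [kc] stands for kappa |c|. *)
Lemma step_conditions (mu omega d D w0 beta0 beta1 G kc e : R) :
  0 <= mu -> 0 < omega -> 0 <= d <= D -> 0 < w0 -> 0 <= kc -> `|e| <= mu * kc ->
  beta1 <= 1 / 4 -> 0 <= beta0 + (8 * beta1 - 2) / (1 + G) ->
  mu * (w0 * D * (beta0 + (8 * beta1 - 2) / (1 + G)) + kc) <= omega * w0 ->
  mu * (4 * D * (1 - 4 * beta1)) <= omega * (1 - G ^+ 2) ->
  kc <= 2 * w0 * (d * (beta0 - 1)) ->
  [/\ `|e / w0| / 2 <= mu * d * (beta0 - 1),
      mu * d * (beta0 + (8 * beta1 - 2) / (1 + G)) + `|e / w0| / 2 <= omega
    & mu * d * (4 * (1 - 4 * beta1)) <= omega * (1 - G ^+ 2)].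
Proof.
move=> mu0 o0 /andP[d0 dD] w0_gt0 kc0 ekc b4.
move: (beta0 + _) => B B0 h1 h2 h3.
rewrite normrM normfV (gtr0_norm w0_gt0); split.
- rewrite !ler_pdivrMr// (le_trans ekc)//.
  have -> : mu * d * (beta0 - 1) * 2 * w0 = mu * (2 * w0 * (d * (beta0 - 1))) by ring.
  by rewrite ler_wpM2l.
- rewrite -(ler_pM2r w0_gt0) (le_trans _ h1)// mulrDr mulrDl; apply: lerD.
    have -> : mu * d * B * w0 = mu * (w0 * d * B) by ring.
    by rewrite ler_wpM2l// ler_wpM2r// ler_wpM2l// ltW.
  rewrite mulrAC divfK ?gt_eqF// (le_trans _ ekc)// ler_pdivrMr// ler_peMr//.
  by rewrite ler1n.
- apply: (le_trans _ h2); have b0 : 0 <= 1 - 4 * beta1 by lra.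
  have -> : mu * d * (4 * (1 - 4 * beta1)) = mu * (4 * d * (1 - 4 * beta1)) by ring.
  by rewrite ler_wpM2l// ler_wpM2r// ler_wpM2l.
Qed.

End StabilityConstants.

(** * The update of the cell averages *)

Section CellAverageUpdate.
Context (R : realType) (m : mesh R) (M : R -> R -> R) (l : nat) (z w : nat -> R).
Context (a b c beta0 beta1 kappa gx gy c1 c2 : R) (u : broken m).
Local Notation L := l.+3.
Implicit Types (i : 'I_(nx m)) (j : 'I_(ny m)).
Hypothesis hGL : gauss_lobatto L z w.
Hypothesis hM : admissible_weight m L z M.
Hypothesis hA : nonneg_definite a b c.
Hypothesis hkappa : 0 < kappa.
Hypothesis hmesh : kappa^-1 <= dx m / dy m <= kappa.
Hypothesis hbeta0 : 1 + kappa * `|c| / (2 * w 0%N * Num.min a b) <= beta0.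
Hypothesis hbeta1 : 1 / 8 <= beta1 <= 1 / 4.
Hypothesis hgamma : gammas_admissible m M L z gx gy beta1.
Hypothesis Vu : Vh 2 u.
Hypothesis hu : forall i j x y,
  test_set L z gx gy i j (x, y) -> c1 <= u i j x y <= c2.

Local Notation lm := (@lebesgue_measure R).
Local Notation G := (Num.max `|gx| `|gy|).
Local Notation weightX i j s := (fun t => M (xat i t) (yat j (z s))).
Local Notation weightY i j s := (fun t => M (xat i (z s)) (yat j t)).

Let w0_gt0 : 0 < w 0%N. Proof. exact: gl_end_weight_gt0 hGL. Qed.

Lemma integrable_weightX i j s : (s < L)%N ->
  lm.-integrable `[-1, 1] (EFin \o weightX i j s).
Proof.
move=> sL; have [_ _ + _] := hM; move=> /(_ i j s sL).
by rewrite /Icell xlE xrE => /(integrable_reference (dx_gt0 m)).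
Qed.

Lemma integrable_weightY i j s : (s < L)%N ->
  lm.-integrable `[-1, 1] (EFin \o weightY i j s).
Proof.
move=> sL; have [_ _ _] := hM; move=> /(_ i j s sL).
by rewrite /Jcell ybE ytE => /(integrable_reference (dy_gt0 m)).
Qed.

Lemma weightX_gt0 i j s t : (s < L)%N -> -1 <= t <= 1 -> 0 < weightX i j s t.
Proof.
move=> sL t1; have [M0 _ _ _] := hM; apply/M0/Omega_at => //.
exact: gl_node_itv hGL _ sL.
Qed.

Lemma weightY_gt0 i j s t : (s < L)%N -> -1 <= t <= 1 -> 0 < weightY i j s t.
Proof.
move=> sL t1; have [M0 _ _ _] := hM; apply/M0/Omega_at => //.
exact: gl_node_itv hGL _ sL.
Qed.

Lemma wminX_gt0 i j s : (s < L)%N -> 0 < wmin (wt_avg (weightX i j s)) gx.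
Proof.
move=> sL; have [gX _ _ _] := hgamma.
apply: (wmin_gt0 (integrable_weightX i j sL)); last exact: (gX i j s sL).
by move=> t; exact: weightX_gt0.
Qed.

Lemma wminY_gt0 i j s : (s < L)%N -> 0 < wmin (wt_avg (weightY i j s)) gy.
Proof.
move=> sL; have [_ gY _ _] := hgamma.
apply: (wmin_gt0 (integrable_weightY i j sL)); last exact: (gY i j s sL).
by move=> t; exact: weightY_gt0.
Qed.

Lemma omega_min_gt0 i j : (0 < omega_min M L z gx gy i j)%E.
Proof.
apply: lt_bigmin => [|s _]; first by rewrite ltry.
by rewrite lte_fin lt_min wminX_gt0 ?wminY_gt0.
Qed.

Lemma gamma_lt1 : G < 1.
Proof.
have [gX gY _ _] := hgamma.
pose i := Ordinal (nx_gt0 m); pose j := Ordinal (ny_gt0 m).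
rewrite gt_max !ltr_norml; apply/andP; split.
  apply: (gamma_bounds_lt1 (integrable_weightX i j (ltn0Sn _))).
    by move=> t; exact: weightX_gt0.
  exact: (gX i j 0%N).
apply: (gamma_bounds_lt1 (integrable_weightY i j (ltn0Sn _))).
  by move=> t; exact: weightY_gt0.
exact: (gY i j 0%N).
Qed.

Let G_ge0 : 0 <= G. Proof. by rewrite le_max normr_ge0. Qed.

Let A_ge0 : 0 <= a /\ 0 <= b. Proof. exact: nonneg_definite_diag hA. Qed.

Let beta0_ge1 : 1 <= beta0.
Proof.
have [a0 b0] := A_ge0; apply: le_trans hbeta0; rewrite lerDl divr_ge0//.
  by rewrite mulr_ge0// ltW.
by rewrite !mulr_ge0// ?le_min ?a0// ltW.
Qed.

(* The denominator 1 + G is at least 1 and 8 beta1 - 2 >= -1, so the sum is at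
   least beta0 - 1. *)
Let penalty_ge0 : 0 <= beta0 + (8 * beta1 - 2) / (1 + G).
Proof.
have g1 : 0 < 1 + G by rewrite ltr_pwDl.
have /andP[b1 _] := hbeta1.
rewrite -lerBlDl sub0r (le_trans (_ : - beta0 <= -1)) ?lerN2//.
by rewrite ler_pdivlMr//; move: G_ge0 => *; lra.
Qed.

Local Notation den1 := (w 0%N * Num.max a b * (beta0 + (8 * beta1 - 2) / (1 + G))
                        + kappa * `|c|).
Local Notation den2 := (4 * Num.max a b * (1 - 4 * beta1)).

Let max_ge0 : 0 <= Num.max a b. Proof. by rewrite le_max; have [-> _] := A_ge0. Qed.
Let kc_ge0 : 0 <= kappa * `|c|. Proof. by rewrite mulr_ge0// ltW. Qed.

Let den1_ge0 : 0 <= den1.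
Proof. by rewrite addr_ge0// !mulr_ge0// ltW. Qed.

Let den2_ge0 : 0 <= den2.
Proof.
have /andP[_ b1] := hbeta1; rewrite !mulr_ge0//.
by lra.
Qed.

Let G2_gt0 : 0 < 1 - G ^+ 2.
Proof. by rewrite subr_gt0 expr_lt1// gamma_lt1. Qed.

Lemma mu_bound_gt0 :
  (0 < mu_bound m M L z w gx gy a b c beta0 beta1 kappa)%E.
Proof.
apply: mule_gt0.
  apply: lt_bigmin => [|i _]; first by rewrite ltry.
  by apply: lt_bigmin => [|j _]; [rewrite ltry|exact: omega_min_gt0].
by rewrite lt_min !quot_oo_gt0.
Qed.

(** Clearing the two denominators of [mu_bound]: a vanishing denominator makes the
    corresponding inequality trivial. *)
Lemma mu_bound_le i j s omega (mu0 : R) : (s < L)%N ->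
  omega = wmin (wt_avg (weightX i j s)) gx \/ omega = wmin (wt_avg (weightY i j s)) gy ->
  (mu0%:E <= mu_bound m M L z w gx gy a b c beta0 beta1 kappa)%E ->
  mu0 * den1 <= omega * w 0%N /\ mu0 * den2 <= omega * (1 - G ^+ 2).
Proof.
move=> sL omegaE mu0_le.
have o0 : 0 < omega by case: omegaE => ->; [exact: wminX_gt0|exact: wminY_gt0].
have mu0_le' : (mu0%:E <= omega%:E * Order.min (quot_oo (w 0%N) den1)
                                               (quot_oo (1 - G ^+ 2) den2))%E.
  apply: (le_trans mu0_le); apply: lee_wpmul2r.
    by rewrite ltW// lt_min !quot_oo_gt0.
  apply: (le_trans (bigmin_le _ i _)); apply: (le_trans (bigmin_le _ j _)).
  apply: (le_trans (bigmin_le _ (Ordinal sL) _)); rewrite lee_fin.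
  by case: omegaE => ->; rewrite ge_min lexx ?orbT.
have omega_ge0 : (0 <= omega%:E)%E by rewrite lee_fin ltW.
by split; apply: le_quot_oo => //; apply: (le_trans mu0_le');
  apply: lee_wpmul2l => //; rewrite ge_min lexx ?orbT.
Qed.

Section Step.
Variable tau : R.
Hypothesis tau_gt0 : 0 < tau.
Hypothesis mu_le : ((mu m tau)%:E <= mu_bound m M L z w gx gy a b c beta0 beta1 kappa)%E.

Let dx0 := dx_gt0 m.
Let dy0 := dy_gt0 m.
Let mux_gt0 : 0 < mux m tau. Proof. by rewrite divr_gt0// exprn_gt0. Qed.
Let muy_gt0 : 0 < muy m tau. Proof. by rewrite divr_gt0// exprn_gt0. Qed.
Let mu_gt0 : 0 < mu m tau. Proof. exact: addr_gt0. Qed.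

(* The factor of the mixed term in one direction: tau / (dx dy) is mu_x times
   dx / dy, and mu_y times dy / dx. *)
Let cross_le (ratio : R) : 0 < ratio <= kappa ->
  `|c * mu m tau * ratio| <= mu m tau * (kappa * `|c|).
Proof.
move=> /andP[r0 rk]; rewrite !normrM (gtr0_norm mu_gt0) (gtr0_norm r0).
by rewrite mulrAC mulrC [`|c| * _]mulrC (ler_wpM2l (ltW mu_gt0))// ler_wpM2r.
Qed.

Let ratioX : 0 < dx m / dy m <= kappa.
Proof. by have /andP[_ ->] := hmesh; rewrite divr_gt0. Qed.

Let ratioY : 0 < dy m / dx m <= kappa.
Proof.
have /andP[+ _] := hmesh; rewrite divr_gt0//= -[dy m / dx m]invrK invf_div.
by rewrite -[X in _ -> _ <= X]invrK lef_pV2// posrE ?invr_gt0// divr_gt0.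
Qed.

Let conditions i j s omega (d e : R) : (s < L)%N ->
  omega = wmin (wt_avg (weightX i j s)) gx \/ omega = wmin (wt_avg (weightY i j s)) gy ->
  d = a \/ d = b -> `|e| <= mu m tau * (kappa * `|c|) ->
  [/\ `|e / w 0%N| / 2 <= mu m tau * d * (beta0 - 1),
      mu m tau * d * (beta0 + (8 * beta1 - 2) / (1 + G)) + `|e / w 0%N| / 2 <= omega
    & mu m tau * d * (4 * (1 - 4 * beta1)) <= omega * (1 - G ^+ 2)].
Proof.
move=> sL omegaE dE e_le.
have o0 : 0 < omega by case: omegaE => ->; [exact: wminX_gt0|exact: wminY_gt0].
have [h1 h2] := mu_bound_le sL omegaE mu_le.
have /andP[_ b4] := hbeta1; have [a0 b0] := A_ge0.
apply: (step_conditions (D := Num.max a b) (kc := kappa * `|c|)) => //.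
- exact: ltW.
- by case: dE => ->; rewrite ?a0 ?b0 le_max lexx ?orbT.
- apply: (penalty_dominates_cross hA w0_gt0 _ hbeta0 hkappa).
  by case: dE => ->; rewrite ge_min lexx ?orbT.
Qed.

(** The vertical edges of the mixed term are attached to the sum of H1, whose first
    and last nodes lie on the horizontal mesh lines that contain the corners. *)
Lemma sum_H1_bounds i j :
  c1 * (\sum_(s < L) w s * wt_avg (weightX i j s) (fun=> 1))
  <= \sum_(s < L) w s * H1 M a beta0 beta1 tau u i j (yat j (z s))
     + c * mu m tau * (dx m / dy m)
       * ((meanX u i j (yt j) - meanX u (ord_pred i) j (yt j))
          - (meanX u i j (yb j) - meanX u (ord_pred i) j (yb j)))
  <= c2 * (\sum_(s < L) w s * wt_avg (weightX i j s) (fun=> 1)).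
Proof.
have [z0 zL _ _] := hGL; rewrite /= in zL.
have -> : yt j = yat j (z l.+2) by rewrite zL yat1.
have -> : yb j = yat j (z 0%N) by rewrite z0 yatN1.
rewrite -!(mean_diff_X Vu).
have -> : \sum_(s < L) w s * H1 M a beta0 beta1 tau u i j (yat j (z s)) =
  \sum_(s < L) w s *
    (wt_avg (weightX i j s) (horner (Xref Vu i j (yat j (z s))))
     + mu m tau * a *
       (ref_flux beta0 beta1 (Xref Vu i j (yat j (z s))) (Xref Vu (ordS i) j (yat j (z s)))
        - ref_flux beta0 beta1 (Xref Vu (ord_pred i) j (yat j (z s)))
            (Xref Vu i j (yat j (z s))))).
  apply: eq_bigr => s _; congr (_ * _); apply: H1_reference.
  by have [_ _ + _] := hM; exact.
have [_ _ gb _] := hgamma; have /andP[_ b4] := hbeta1; have [a0 b0] := A_ge0.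
apply: (direction_bounds hGL (G := G) (g := gx)
  (N := fun s => weightX i j s)
  (p := fun s => Xref Vu i j (yat j (z s)))
  (q := fun s => Xref Vu (ordS i) j (yat j (z s)))
  (r := fun s => Xref Vu (ord_pred i) j (yat j (z s)))) => //.
- by rewrite le_max lexx.
- exact: gamma_lt1.
- by rewrite mulr_ge0// ltW.
- by have [] := @conditions i j _ _ _ _ (ltn0Sn _) (or_introl erefl) (or_introl erefl) (cross_le ratioX).
- move=> s sL.
  have [_ h1 h2] := @conditions i j _ _ _ _ sL (or_introl erefl) (or_introl erefl) (cross_le ratioX).
  split=> //; first exact: integrable_weightX.
  by move=> t; exact: weightX_gt0.
- by move=> s sL; split; apply: size_pullback; exact: size_Xpoly.
- move=> s t sL; rewrite !inE => ht; rewrite !horner_Xref.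
  have mem i' : c1 <= u i' j (xat i' t) (yat j (z s)) <= c2.
    apply: hu; left; split=> /=; last by exists s.
    exists t => //=; case/or3P: ht => /eqP ->; by [left; left|left; right|right].
  by split; exact: mem.
Qed.

Lemma sum_H2_bounds i j :
  c1 * (\sum_(s < L) w s * wt_avg (weightY i j s) (fun=> 1))
  <= \sum_(s < L) w s * H2 M b beta0 beta1 tau u i j (xat i (z s))
     + c * mu m tau * (dy m / dx m)
       * ((meanY u i j (xr i) - meanY u i (ord_pred j) (xr i))
          - (meanY u i j (xl i) - meanY u i (ord_pred j) (xl i)))
  <= c2 * (\sum_(s < L) w s * wt_avg (weightY i j s) (fun=> 1)).
Proof.
have [z0 zL _ _] := hGL; rewrite /= in zL.
have -> : xr i = xat i (z l.+2) by rewrite zL xat1.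
have -> : xl i = xat i (z 0%N) by rewrite z0 xatN1.
rewrite -!(mean_diff_Y Vu).
have -> : \sum_(s < L) w s * H2 M b beta0 beta1 tau u i j (xat i (z s)) =
  \sum_(s < L) w s *
    (wt_avg (weightY i j s) (horner (Yref Vu i j (xat i (z s))))
     + mu m tau * b *
       (ref_flux beta0 beta1 (Yref Vu i j (xat i (z s))) (Yref Vu i (ordS j) (xat i (z s)))
        - ref_flux beta0 beta1 (Yref Vu i (ord_pred j) (xat i (z s)))
            (Yref Vu i j (xat i (z s))))).
  apply: eq_bigr => s _; congr (_ * _); apply: H2_reference.
  by have [_ _ _] := hM; exact.
have [_ _ _ gb] := hgamma; have /andP[_ b4] := hbeta1; have [a0 b0] := A_ge0.
apply: (direction_bounds hGL (G := G) (g := gy)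
  (N := fun s => weightY i j s)
  (p := fun s => Yref Vu i j (xat i (z s)))
  (q := fun s => Yref Vu i (ordS j) (xat i (z s)))
  (r := fun s => Yref Vu i (ord_pred j) (xat i (z s)))) => //.
- by rewrite le_max lexx orbT.
- exact: gamma_lt1.
- by rewrite mulr_ge0// ltW.
- by have [] := @conditions i j _ _ _ _ (ltn0Sn _) (or_intror erefl) (or_intror erefl) (cross_le ratioY).
- move=> s sL.
  have [_ h1 h2] := @conditions i j _ _ _ _ sL (or_intror erefl) (or_intror erefl) (cross_le ratioY).
  split=> //; first exact: integrable_weightY.
  by move=> t; exact: weightY_gt0.
- by move=> s sL; split; apply: size_pullback; exact: size_Ypoly.
- move=> s t sL; rewrite !inE => ht; rewrite !horner_Yref.
  have mem j' : c1 <= u i j' (xat i (z s)) (yat j' t) <= c2.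
    apply: hu; right; split=> /=; first by exists s.
    exists t => //=; case/or3P: ht => /eqP ->; by [left; left|left; right|right].
  by split; exact: mem.
Qed.

Lemma lineX_one i j s : (s < L)%N ->
  lineX M (uone m) i j (yat j (z s)) = wt_avg (weightX i j s) (fun=> 1).
Proof.
move=> sL; have [_ _ + _] := hM; move=> /(_ i j s sL).
rewrite /lineX /intI /Icell xlE xrE => Mi.
have := line_average_pullback 1 (dx_gt0 m) Mi.
have -> : horner (pullback (xcenter i) (dx m) 1) = fun=> 1.
  by apply/funext => t; rewrite horner_pullback hornerE.
by move=> <-; congr (_ * _); apply: eq_Rintegral => x _; rewrite !hornerE /uone ?mulr1.
Qed.

Lemma lineY_one i j s : (s < L)%N ->
  lineY M (uone m) i j (xat i (z s)) = wt_avg (weightY i j s) (fun=> 1).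
Proof.
move=> sL; have [_ _ _] := hM; move=> /(_ i j s sL).
rewrite /lineY /intJ /Jcell ybE ytE => Mi.
have := line_average_pullback 1 (dy_gt0 m) Mi.
have -> : horner (pullback (ycenter j) (dy m) 1) = fun=> 1.
  by apply/funext => t; rewrite horner_pullback hornerE.
by move=> <-; congr (_ * _); apply: eq_Rintegral => y _; rewrite !hornerE /uone ?mulr1.
Qed.

Let sum_weights_gt0 (V : nat -> R) : (forall s, (s < L)%N -> 0 < V s) ->
  0 < \sum_(s < L) w s * V s.
Proof.
move=> V0; rewrite big_ord_recl; apply: ltr_wpDr; last exact: mulr_gt0 (V0 _ _).
apply: sumr_ge0 => s _; apply: mulr_ge0.
  exact: (gl_weight_nonneg hGL (ltn_ord _)).
exact/ltW/V0/ltn_ord.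
Qed.

Lemma wavg_quad_one i j : wavg_quad M tau L z w (uone m) i j =
  mux m tau / mu m tau * (\sum_(s < L) w s * wt_avg (weightX i j s) (fun=> 1))
  + muy m tau / mu m tau * (\sum_(s < L) w s * wt_avg (weightY i j s) (fun=> 1)).
Proof.
rewrite /wavg_quad /quadXY; congr (_ * _ + _ * _); apply: eq_bigr => s _.
  by rewrite lineX_one.
by rewrite lineY_one.
Qed.

Lemma wavg_quad_one_gt0 i j : 0 < wavg_quad M tau L z w (uone m) i j.
Proof.
have rx : 0 < mux m tau / mu m tau by rewrite divr_gt0.
have ry : 0 < muy m tau / mu m tau by rewrite divr_gt0.
rewrite wavg_quad_one; apply: addr_gt0; apply: mulr_gt0 => //.
  apply: (sum_weights_gt0 (V := fun s => wt_avg (weightX i j s) (fun=> 1))) => s sL.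
  by apply: wt_avg1_gt0 (integrable_weightX i j sL) _ => t; exact: weightX_gt0.
apply: (sum_weights_gt0 (V := fun s => wt_avg (weightY i j s) (fun=> 1))) => s sL.
by apply: wt_avg1_gt0 (integrable_weightY i j sL) _ => t; exact: weightY_gt0.
Qed.

(* The weights rx and ry of the two directions turn their mixed terms ex and ey into
   the common factor K of the scheme. *)
Let combine_directions (rx ry W1 W2 S1 S2 ex ey K p1 p2 p3 p4 q1 q2 q3 q4 : R) :
  0 <= rx -> 0 <= ry -> rx * ex = K -> ry * ey = K ->
  c1 * W1 <= S1 + ex * ((p1 - p2) - (p3 - p4)) <= c2 * W1 ->
  c1 * W2 <= S2 + ey * ((q1 - q2) - (q3 - q4)) <= c2 * W2 ->
  c1 * (rx * W1 + ry * W2)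
  <= rx * S1 + ry * S2 + K * ((p1 - p3) - (p2 - p4) + ((q1 - q3) - (q2 - q4)))
  <= c2 * (rx * W1 + ry * W2).
Proof.
move=> rx0 ry0 exK eyK /andP[l1 u1] /andP[l2 u2].
have -> : rx * S1 + ry * S2 + K * ((p1 - p3) - (p2 - p4) + ((q1 - q3) - (q2 - q4)))
    = rx * (S1 + ex * ((p1 - p2) - (p3 - p4)))
      + ry * (S2 + ey * ((q1 - q2) - (q3 - q4))).
  by rewrite mulrDr -{1}exK -eyK; ring.
have scale x : x * (rx * W1 + ry * W2) = rx * (x * W1) + ry * (x * W2) by ring.
by rewrite !scale; apply/andP; split; apply: lerD; rewrite ler_wpM2l.
Qed.

Lemma update_bounds (un1 : broken m) i j :
  wavg_update M a b c beta0 beta1 tau L z w u un1 i j ->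
  c1 <= wavg M un1 i j / wavg_quad M tau L z w (uone m) i j <= c2.
Proof.
move=> E; have W0 := wavg_quad_one_gt0 i j.
rewrite ler_pdivlMr// ler_pdivrMr// E /quadXY /crossB.
rewrite !(intJ_meanX_dY Vu) !(intI_meanY_dX Vu) wavg_quad_one.
have rx : 0 <= mux m tau / mu m tau by rewrite divr_ge0// ltW.
have ry : 0 <= muy m tau / mu m tau by rewrite divr_ge0// ltW.
have ex : mux m tau / mu m tau * (c * mu m tau * (dx m / dy m)) = c * tau / (dx m * dy m).
  by rewrite [in LHS]/mux; field; rewrite !gt_eqF.
have ey : muy m tau / mu m tau * (c * mu m tau * (dy m / dx m)) = c * tau / (dx m * dy m).
  by rewrite [in LHS]/muy; field; rewrite !gt_eqF.
exact: combine_directions rx ry ex ey (sum_H1_bounds i j) (sum_H2_bounds i j).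
Qed.

End Step.
End CellAverageUpdate.

Unset Implicit Arguments.

Theorem theorem3p1 (R : realType) (m : mesh R) (M : R -> R -> R)
    (L : nat) (z w : nat -> R)
    (a b c beta0 beta1 kappa gx gy c1 c2 : R) (un : broken m)
    (k : nat) (hk : k = 2%N)
    (hc : c1 <= c2)
    (hL : (k + 3 <= 2 * L)%N)
    (hGL : gauss_lobatto L z w)
    (hM : admissible_weight m L z M)
    (hA : nonneg_definite a b c)
    (hkappa : 0 < kappa)
    (hmesh : kappa^-1 <= dx m / dy m <= kappa)
    (hbeta0 : 1 + kappa * `|c| / (2 * w 0%N * Num.min a b) <= beta0)
    (hbeta1 : 1 / 8 <= beta1 <= 1 / 4)
    (hgamma : gammas_admissible m M L z gx gy beta1)
    (hVh : Vh k un)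
    (hun : forall i j x y, test_set L z gx gy i j (x, y) -> c1 <= un i j x y <= c2) :
  (forall i j, (0 < omega_min (m := m) M L z gx gy i j)%E) /\
  exists mu0 : \bar R,
    [/\ mu0 = mu_bound m M L z w gx gy a b c beta0 beta1 kappa,
        (0 < mu0)%E
      & forall (tau : R) (un1 : broken m),
          0 < tau ->
          ddg_scheme M a b c beta0 beta1 tau k L z w un un1 ->
          ((mu m tau)%:E <= mu0)%E ->
          forall i j,
            c1 <= wavg M un1 i j / wavg_quad M tau L z w (uone m) i j <= c2
            /\ (wavg_quad M tau L z w (uone m) i j = wavg M (uone m) i j ->
                c1 <= cell_avg M un1 i j <= c2)].
Proof.
subst k; case: L hL hGL hM hgamma hun => [|[|[|l]]] // _ hGL hM hgamma hun.
split; first exact: omega_min_gt0 hGL hM hgamma.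
exists (mu_bound m M l.+3 z w gx gy a b c beta0 beta1 kappa); split=> //.
  exact: (mu_bound_gt0 hGL hM hA hkappa hbeta0 hbeta1 hgamma).
move=> tau un1 tau_gt0 [_ _ hupdate] hmu i j.
have bounds := update_bounds hGL hM hA hkappa hmesh hbeta0 hbeta1 hgamma hVh hun
  tau_gt0 hmu (hupdate i j).
by split=> // quad_exact; rewrite /cell_avg -quad_exact.
Qed.
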